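(* Let $S$ be a finite centrally symmetric point set in the plane that is in convex position. Then there exists a plane geometric graph with vertex set $S$ whose stretch factor is at most $\pi+1$ and whose maximum vertex degree is at most $3$.
   Context: $S$ is centrally symmetric (with respect to the origin) if $-p\in S$ for every $p\in S$. A geometric graph on $S$ has straight-segment edges weighted by Euclidean length; $d_G(u,v)$ is the shortest-path length. Its stretch factor is the smallest $t$ with $d_G(u,v)\le t|uv|$ for all $u,v\in S$. A graph is plane if no two edges cross. *)

(* Defs.v *)
From Stdlib Require Import Reals Lra List.
Import ListNotations.
Open Scope R_scope.

Definition point := (R * R)%type.

Definition pneg (p : point) : point := (- fst p, - snd p).

Definition dist (p q : point) : R :=
  sqrt ((fst p - fst q) ^ 2 + (snd p - snd q) ^ 2).

(* S (a finite point set, given as a duplicate-free list) is centrally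
   symmetric with respect to the origin. *)
Definition centrally_symmetric (S : list point) : Prop :=
  forall p, In p S -> In (pneg p) S.

Definition in_conv_hull (T : list point) (p : point) : Prop :=
  exists w : list R,
    length w = length T /\
    Forall (fun a => 0 <= a) w /\
    fold_right Rplus 0 w = 1 /\
    fst p = fold_right Rplus 0 (map (fun c => fst c * fst (snd c)) (combine w T)) /\
    snd p = fold_right Rplus 0 (map (fun c => fst c * snd (snd c)) (combine w T)).

Definition point_eq_dec (p q : point) : {p = q} + {p <> q}.
Proof.
  destruct p as [a b], q as [c d].
  destruct (Req_dec_T a c) as [H1|H1]; destruct (Req_dec_T b d) as [H2|H2];
    [left; subst; reflexivity | right; congruence | right; congruence | right; congruence].
Defined.

Definition convex_position (S : list point) : Prop :=
  forall p, In p S -> ~ in_conv_hull (remove point_eq_dec p S) p.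

Definition on_segment (a b x : point) : Prop :=
  exists t, 0 <= t <= 1 /\
    fst x = (1 - t) * fst a + t * fst b /\
    snd x = (1 - t) * snd a + t * snd b.

Definition geometric_graph (S : list point) (E : point -> point -> bool) : Prop :=
  (forall p q, E p q = true -> In p S /\ In q S) /\
  (forall p q, E p q = true -> E q p = true) /\
  (forall p, E p p = false).

Definition plane (E : point -> point -> bool) : Prop :=
  forall a b c d x,
    E a b = true -> E c d = true ->
    ~ ((a = c /\ b = d) \/ (a = d /\ b = c)) ->
    on_segment a b x -> on_segment c d x ->
    (x = a \/ x = b) /\ (x = c \/ x = d).

Fixpoint is_walk (E : point -> point -> bool) (u : point) (l : list point) : Prop :=
  match l with
  | [] => True
  | x :: l' => E u x = true /\ is_walk E x l'
  end.

Fixpoint walk_length (u : point) (l : list point) : R :=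
  match l with
  | [] => 0
  | x :: l' => dist u x + walk_length x l'
  end.

(* Stretch factor at most t: d_G(u,v) <= t |uv| for all u, v in S, where
   d_G(u,v) is the minimum length of a walk from u to v (finitely many
   simple paths, so the minimum is attained if some walk exists). *)
Definition stretch_at_most (S : list point) (E : point -> point -> bool) (t : R) : Prop :=
  forall u v, In u S -> In v S ->
    exists l, is_walk E u l /\ last l u = v /\ walk_length u l <= t * dist u v.

Definition degree (S : list point) (E : point -> point -> bool) (p : point) : nat :=
  length (filter (E p) S).

Definition max_degree_at_most (S : list point) (E : point -> point -> bool) (k : nat) : Prop :=
  forall p, In p S -> (degree S E p <= k)%nat.

(* Main.v *)
(* Let p be a point of S farthest from the origin. The line through p and -p cuts the
   convex polygon into two chains contained in the disk with diameter [-p, p]. For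
   u, w, v in this order on a chain, the angle uwv contains the angle (-p)wp, which is at
   least a right angle, so the part of the chain between u and v is a convex curve inside
   the half disk with diameter uv, and its length is at most (PI / 2) |uv|.

   The two chains are joined by a matching: take a closest pair (r, s) of one point in each
   chain and recurse on both sides of the line rs. If u and v lie on different chains and
   are separated by rs, then uv and rs are the diagonals of a convex quadrilateral, so
   |ur| + |sv| <= |uv| + |rs| <= 2 |uv|, and going from u to r, s, v costs at most
   (PI / 2) 2 |uv| + |uv| = (PI + 1) |uv|. Each point has at most two neighbours on its
   chain and at most one in the matching. *)

From Stdlib Require Import Reals Lra Lia Psatz List Permutation Sorted.
Require Import Defs.
Import ListNotations.
Open Scope R_scope.

(** The main obstacle is the factor PI / 2 for a chain, which is usually quoted from the
    monotonicity of length for nested convex curves. Here it comes from an induction over vertices: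
    each edge is prolonged until it leaves the disk, and the arc still ahead of the exit point pays
    for the rest of the chain, so that chord <= arc is the only fact needed about the circle.
    Central symmetry enters by putting -p into S: the scalar product of p - w and -p - w is |w|^2 -
    |p|^2, which is nonpositive for the farthest p. Everything else is read off from signs of areas.
    The boundary of the polygon becomes one list in which every triple, taken in list order, turns
    right. Sublists inherit this, so it survives the recursion of the matching and also decides
    planarity. *)

(** * Order-preserving sublists, sorting and minimisers *)

Inductive subseq {A : Type} : list A -> list A -> Prop :=
| subseq_nil : forall L, subseq [] L
| subseq_take : forall x l L, subseq l L -> subseq (x :: l) (x :: L)
| subseq_skip : forall x l L, subseq l L -> subseq l (x :: L).

Lemma subseq_refl {A} (L : list A) : subseq L L.
Proof. induction L; constructor; auto. Qed.

Lemma subseq_trans {A} (l1 l2 l3 : list A) :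
  subseq l1 l2 -> subseq l2 l3 -> subseq l1 l3.
Proof.
  intros H12 H23; revert l1 H12.
  induction H23 as [L|x l L H IH|x l L H IH]; intros l1 H12.
  - inversion H12; constructor.
  - inversion H12; subst; constructor; auto.
  - constructor; auto.
Qed.

Lemma subseq_app_left {A} (l L1 L2 : list A) : subseq l L2 -> subseq l (L1 ++ L2).
Proof. induction L1; simpl; [auto | constructor; auto]. Qed.

Lemma subseq_app {A} (l1 l2 L1 L2 : list A) :
  subseq l1 L1 -> subseq l2 L2 -> subseq (l1 ++ l2) (L1 ++ L2).
Proof.
  intros H1 H2; induction H1; simpl.
  - now apply subseq_app_left.
  - constructor; auto.
  - constructor; auto.
Qed.

Lemma subseq_single {A} (x : A) L : In x L -> subseq [x] L.
Proof.
  induction L as [|y L IH]; intros [].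
  - subst; repeat constructor.
  - constructor; auto.
Qed.

Lemma subseq_incl {A} (l L : list A) x : subseq l L -> In x l -> In x L.
Proof. intros H; induction H; simpl; intuition. Qed.

Lemma subseq_app_inv {A} (l L1 L2 : list A) :
  subseq l (L1 ++ L2) ->
  exists l1 l2, l = l1 ++ l2 /\ subseq l1 L1 /\ subseq l2 L2.
Proof.
  revert l; induction L1 as [|x L1 IH]; simpl; intros l H.
  - exists [], l; repeat split; [constructor | assumption].
  - inversion H as [|y l' L' H'|y l' L' H']; subst.
    + exists [], []; repeat constructor.
    + destruct (IH _ H') as (l1 & l2 & -> & H1 & H2).
      exists (x :: l1), l2; repeat split; [constructor|]; assumption.
    + destruct (IH _ H') as (l1 & l2 & -> & H1 & H2).
      exists l1, l2; repeat split; [constructor|]; assumption.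
Qed.

Lemma subseq_StronglySorted {A} (R : A -> A -> Prop) L a b l :
  StronglySorted R L -> subseq (a :: b :: l) L -> R a b.
Proof.
  intros HS; induction HS as [|x L HS IH HF]; intros H; inversion H; subst; auto.
  rewrite Forall_forall in HF; apply HF.
  eapply subseq_incl; [eassumption | left; reflexivity].
Qed.

Lemma exists_StronglySorted {A} (key : A -> R) (L : list A) :
  NoDup L ->
  (forall x y, In x L -> In y L -> key x = key y -> x = y) ->
  exists L', Permutation L L' /\ StronglySorted (fun x y => key x < key y) L'.
Proof.
  intros Hnd; induction Hnd as [|x L Hx Hnd IH]; intros Hinj.
  - exists []; split; constructor.
  - destruct IH as (L' & HP & HS).
    { intros; apply Hinj; simpl; auto. }
    assert (Hne : forall y, In y L' -> key x <> key y).
    { intros y Hy He. apply Hx. rewrite (Hinj x y); simpl; auto.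
      - eapply Permutation_in; [symmetry; eassumption | assumption].
      - right; eapply Permutation_in; [symmetry; eassumption | assumption]. }
    assert (Hins : exists L'', Permutation (x :: L') L'' /\
      StronglySorted (fun x y => key x < key y) L'').
    { clear HP Hinj Hx. induction HS as [|y L' HS IH HF].
      - exists [x]; split; [reflexivity | repeat constructor].
      - destruct (Rlt_dec (key x) (key y)) as [Hlt|Hge].
        + exists (x :: y :: L'); split; [reflexivity|].
          repeat constructor; auto.
          eapply Forall_impl; [|exact HF]; simpl; intros; lra.
        + assert (Hyx : key y < key x).
          { pose proof (Hne y (or_introl eq_refl)); lra. }
          destruct IH as (L'' & HP & HS').
          { intros z Hz; apply Hne; right; assumption. }
          exists (y :: L''); split.
          * transitivity (y :: x :: L'); [apply perm_swap | now constructor].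
          * constructor; [assumption|].
            eapply Permutation_Forall; [exact HP|]. constructor; assumption. }
    destruct Hins as (L'' & HP' & HS').
    exists L''; split; [|assumption].
    transitivity (x :: L'); [now constructor | assumption].
Qed.

Lemma exists_argmin {A} (f : A -> R) (l : list A) :
  l <> [] -> exists x, In x l /\ forall y, In y l -> f x <= f y.
Proof.
  induction l as [|a l IH]; intros H; [congruence|].
  destruct l as [|b l].
  - exists a; split; [now left | intros y [->|[]]; lra].
  - destruct IH as (x & Hx & Hmin); [congruence|].
    destruct (Rle_dec (f a) (f x)).
    + exists a; split; [now left | intros y [->|Hy]; [lra|]].
      specialize (Hmin y Hy); lra.
    + exists x; split; [now right | intros y [->|Hy]; [lra|auto]].
Qed.

(** * Convex hulls and distances *)

(** The coordinate sums of [in_conv_hull] with the coordinate as parameter. It is convertible to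
    them at [fst] and [snd], so one induction treats both. *)
Definition comb (w : list R) (T : list point) (f : point -> R) : R :=
  fold_right Rplus 0 (map (fun c => fst c * f (snd c)) (combine w T)).

Lemma comb_zero T f : comb (map (fun _ => 0) T) T f = 0.
Proof. unfold comb; induction T; simpl; [|rewrite IHT]; lra. Qed.

Lemma in_conv_hull_In T a : In a T -> in_conv_hull T a.
Proof.
  induction T as [|b T IH]; intros H; [easy|].
  destruct (point_eq_dec b a) as [->|Hne].
  - exists (1 :: map (fun _ => 0) T); simpl; repeat split.
    + now rewrite length_map.
    + constructor; [lra|]. apply Forall_map, Forall_forall; intros; lra.
    + clear; induction T; simpl; lra.
    + change (fst a = 1 * fst a + comb (map (fun _ => 0) T) T fst); rewrite comb_zero; lra.
    + change (snd a = 1 * snd a + comb (map (fun _ => 0) T) T snd); rewrite comb_zero; lra.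
  - destruct H as [->|H]; [congruence|].
    destruct (IH H) as (w & Hl & Hn & Hs & Hx & Hy).
    exists (0 :: w); simpl; repeat split.
    + now rewrite Hl.
    + constructor; [lra|assumption].
    + lra.
    + change (fst a = 0 * fst b + comb w T fst); change (fst a = comb w T fst) in Hx; lra.
    + change (snd a = 0 * snd b + comb w T snd); change (snd a = comb w T snd) in Hy; lra.
Qed.

Lemma in_conv_hull_segment T a b x :
  in_conv_hull T a -> in_conv_hull T b -> on_segment a b x -> in_conv_hull T x.
Proof.
  intros (w1 & Hl1 & Hn1 & Hs1 & Hx1 & Hy1) (w2 & Hl2 & Hn2 & Hs2 & Hx2 & Hy2)
    (t & Ht & Hx & Hy).
  (* The weights of [x] are the mixture (1 - t) w1 + t w2, taken entry by entry. *)
  assert (H : exists w, length w = length T /\ Forall (fun a => 0 <= a) w /\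
    fold_right Rplus 0 w
      = (1 - t) * fold_right Rplus 0 w1 + t * fold_right Rplus 0 w2 /\
    forall f, comb w T f = (1 - t) * comb w1 T f + t * comb w2 T f).
  { clear - Hl1 Hl2 Hn1 Hn2 Ht.
    revert w1 w2 Hl1 Hl2 Hn1 Hn2; induction T as [|c T IH]; intros w1 w2 Hl1 Hl2 Hn1 Hn2.
    - destruct w1, w2; try discriminate.
      exists []; unfold comb; simpl; repeat split; auto; intros; lra.
    - destruct w1 as [|a1 w1], w2 as [|a2 w2]; try discriminate.
      inversion Hn1; subst; inversion Hn2; subst.
      destruct (IH w1 w2) as (w & Hl & Hn & Hs & Hf); auto.
      exists ((1 - t) * a1 + t * a2 :: w); simpl; repeat split.
      + now rewrite Hl.
      + constructor; [nra|assumption].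
      + rewrite Hs; lra.
      + intros f; specialize (Hf f); unfold comb in *; simpl; rewrite Hf; lra. }
  destruct H as (w & Hl & Hn & Hs & Hf).
  exists w; repeat split; auto.
  - rewrite Hs, Hs1, Hs2; lra.
  - change (fst x = comb w T fst); rewrite Hf, Hx, Hx1, Hx2; reflexivity.
  - change (snd x = comb w T snd); rewrite Hf, Hy, Hy1, Hy2; reflexivity.
Qed.

Lemma dist_triangle a b c : dist a c <= dist a b + dist b c.
Proof.
  pose proof (triangle (fst a) (snd a) (fst c) (snd c) (fst b) (snd b)) as H.
  unfold dist_euc in H; rewrite !Rsqr_pow2 in H; exact H.
Qed.

Lemma dist_sym a b : dist a b = dist b a.
Proof. unfold dist; f_equal; ring. Qed.

Lemma dist_refl a : dist a a = 0.
Proof.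
  unfold dist; rewrite <- sqrt_0; f_equal; ring.
Qed.

Lemma dist_nonneg a b : 0 <= dist a b.
Proof. apply sqrt_pos. Qed.

Lemma dist_scale a b c d k :
  0 <= k ->
  (fst c - fst d) ^ 2 + (snd c - snd d) ^ 2
    = k ^ 2 * ((fst a - fst b) ^ 2 + (snd a - snd b) ^ 2) ->
  dist c d = k * dist a b.
Proof.
  intros Hk H; unfold dist; rewrite H, sqrt_mult, sqrt_pow2; try assumption;
    [reflexivity | apply pow2_ge_0 |].
  apply Rplus_le_le_0_compat; apply pow2_ge_0.
Qed.

Lemma dist_segment a b x t :
  0 <= t <= 1 -> fst x = (1 - t) * fst a + t * fst b ->
  snd x = (1 - t) * snd a + t * snd b ->
  dist a x + dist x b = dist a b.
Proof.
  intros Ht Hx Hy.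
  rewrite (dist_scale a b a x t), (dist_scale a b x b (1 - t)); try lra;
    rewrite Hx, Hy; ring.
Qed.

(** * Orientation and convex quadrilaterals *)

(** Twice the signed area of the triangle [a b c], negative for a right turn at [b]. *)
Definition orient (a b c : point) : R :=
  (fst b - fst a) * (snd c - snd a) - (snd b - snd a) * (fst c - fst a).

Lemma orient_rot a b c : orient a b c = orient b c a.
Proof. unfold orient; ring. Qed.

Lemma orient_swap a b c : orient a b c = - orient a c b.
Proof. unfold orient; ring. Qed.

(** Strict convexity and boundary order in one condition. Quantifying over all ordered triples, not
    only consecutive ones, makes it hereditary for sublists. *)
Definition clockwise (L : list point) : Prop :=
  forall a b c, subseq [a; b; c] L -> orient a b c < 0.

Lemma clockwise_subseq l L : subseq l L -> clockwise L -> clockwise l.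
Proof. intros Hl H a b c Habc; apply H; eapply subseq_trans; eassumption. Qed.

(** The diagonals meet in a point [x]; the triangle inequality in [a x b] and in [c x d] bounds the
    two opposite sides. *)
Lemma sides_le_diagonals a b c d :
  clockwise [a; b; c; d] -> dist a b + dist c d <= dist a c + dist b d.
Proof.
  intros H.
  assert (H1 : orient a b c < 0) by (apply H; repeat constructor).
  assert (H2 : orient a b d < 0) by (apply H; repeat constructor).
  assert (H3 : orient a c d < 0) by (apply H; repeat constructor).
  assert (H4 : orient b c d < 0) by (apply H; repeat constructor).
  assert (E : orient a b c + orient a c d = orient a b d + orient b c d)
    by (unfold orient; ring).
  set (D := orient a b d + orient b c d) in *.
  (* [D] is twice the signed area of the quadrilateral. The diagonal [b d] cuts [a c] in the ratio
     of the areas on its two sides, which gives [t]; likewise [s] on [b d]. *)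
  set (t := orient a b d / D).
  set (s := orient a b c / D).
  assert (Et : t * D = orient a b d) by (unfold t; field; unfold D; lra).
  assert (Es : s * D = orient a b c) by (unfold s; field; unfold D; lra).
  assert (HD : D < 0) by (unfold D; lra).
  assert (Ht : 0 <= t <= 1) by (unfold D in *; split; nra).
  assert (Hs : 0 <= s <= 1) by (split; nra).
  set (x := ((1 - t) * fst a + t * fst c, (1 - t) * snd a + t * snd c)).
  assert (D1 : dist a x + dist x c = dist a c).
  { apply (dist_segment a c x t); auto. }
  assert (D2 : dist b x + dist x d = dist b d).
  { apply (dist_segment b d x s); auto; simpl;
      apply Rmult_eq_reg_r with D; try lra.
    - transitivity ((D - t * D) * fst a + t * D * fst c); [ring|].
      transitivity ((D - s * D) * fst b + s * D * fst d); [|ring].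
      rewrite Et, Es; unfold D, orient; ring.
    - transitivity ((D - t * D) * snd a + t * D * snd c); [ring|].
      transitivity ((D - s * D) * snd b + s * D * snd d); [|ring].
      rewrite Et, Es; unfold D, orient; ring. }
  pose proof (dist_triangle a x b); pose proof (dist_triangle c x d).
  rewrite (dist_sym x b) in *; rewrite (dist_sym c x) in *; lra.
Qed.

(** * Length of a convex chain in a half disk *)

(** Squared chord against squared arc on the unit circle: the left side is (2 sin (t / 2))^2. *)
Lemma cos_ge_quadratic t : 0 <= t -> 2 - 2 * cos t <= t ^ 2.
Proof.
  intros Ht.
  replace (cos t) with (1 - 2 * sin (t / 2) * sin (t / 2))
    by (rewrite <- cos_2a_sin; f_equal; lra).
  assert (Hs : Rabs (sin (t / 2)) <= t / 2).
  { destruct (Req_dec t 0) as [->|Hne].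
    - replace (0 / 2) with 0 by lra. rewrite sin_0, Rabs_R0; lra.
    - pose proof (sin_lt_x (t / 2)) as H1.
      pose proof (SIN_bound (t / 2)) as H3.
      apply Rabs_le; split; [|lra].
      destruct (Rle_dec (t / 2) 1) as [Hle|Hgt]; [|lra].
      assert (0 <= sin (t / 2)) by
        (apply sin_ge_0; [lra | pose proof PI2_1; lra]).
      lra. }
  pose proof (Rabs_pos (sin (t / 2))).
  assert (sin (t / 2) * sin (t / 2) <= t / 2 * (t / 2)).
  { replace (sin (t / 2) * sin (t / 2)) with (Rabs (sin (t / 2)) * Rabs (sin (t / 2)))
      by (rewrite <- Rabs_mult; apply Rabs_right; nra).
    nra. }
  nra.
Qed.

Definition normsq (a : point) : R := fst a ^ 2 + snd a ^ 2.

Lemma normsq_le_1_fst a : normsq a <= 1 -> -1 <= fst a <= 1.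
Proof. unfold normsq; intros; nra. Qed.

(** On the upper unit semicircle [acos (fst z)] is the polar angle of [z], so the right side is the
    length of the arc between the two points. *)
Lemma chord_le_arc (z z' : point) :
  normsq z = 1 -> normsq z' = 1 -> 0 <= snd z -> 0 <= snd z' ->
  fst z <= fst z' -> dist z z' <= acos (fst z) - acos (fst z').
Proof.
  intros Hz Hz' Hy Hy' Hle.
  pose proof (normsq_le_1_fst z ltac:(lra)) as Bz.
  pose proof (normsq_le_1_fst z' ltac:(lra)) as Bz'.
  assert (Hs : forall w, normsq w = 1 -> 0 <= snd w -> sin (acos (fst w)) = snd w).
  { intros w Hw Hw'. rewrite sin_acos by (apply normsq_le_1_fst; lra).
    apply sqrt_lem_1; unfold normsq, Rsqr in *; nra. }
  assert (Hmono : acos (fst z') <= acos (fst z)).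
  { destruct (Rle_dec (acos (fst z')) (acos (fst z))) as [|Hgt]; [assumption|].
    exfalso. pose proof (acos_bound (fst z)); pose proof (acos_bound (fst z')).
    assert (H1 : cos (acos (fst z')) < cos (acos (fst z)))
      by (apply cos_decreasing_1; lra).
    rewrite !cos_acos in H1 by lra; lra. }
  pose proof (cos_ge_quadratic (acos (fst z) - acos (fst z')) ltac:(lra)) as HQ.
  rewrite cos_minus, !cos_acos, !Hs in HQ by assumption.
  unfold dist.
  rewrite <- (sqrt_pow2 (acos (fst z) - acos (fst z'))) by lra.
  apply sqrt_le_1_alt. unfold normsq in *. nra.
Qed.

(** Along the ray, [normsq] minus 1 is the quadratic A s^2 + 2 B s + |a|^2 - 1. At s = 1 it is
    nonpositive because [b] lies in the disk, so its larger root is at least 1. *)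
Lemma ray_hits_circle (a b : point) :
  normsq a <= 1 -> normsq b <= 1 -> a <> b ->
  exists s, 1 <= s /\
    normsq (fst a + s * (fst b - fst a), snd a + s * (snd b - snd a)) = 1.
Proof.
  intros Ha Hb Hne.
  set (dx := fst b - fst a); set (dy := snd b - snd a).
  set (A := dx ^ 2 + dy ^ 2).
  set (B := fst a * dx + snd a * dy).
  assert (HA : 0 < A).
  { destruct (Req_dec dx 0); [destruct (Req_dec dy 0)|].
    - exfalso; apply Hne; destruct a, b; simpl in *; f_equal; unfold dx, dy in *; lra.
    - unfold A; nra.
    - unfold A; nra. }
  assert (H1 : A + 2 * B + normsq a - 1 <= 0).
  { unfold A, B, dx, dy, normsq in *; nra. }
  set (D := B ^ 2 - A * (normsq a - 1)).
  (* [D - (A + B) ^ 2] is [- A] times the value of the quadratic at 1. *)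
  assert (HD : (A + B) ^ 2 <= D) by (unfold D; nra).
  assert (HD0 : 0 <= D) by (pose proof (pow2_ge_0 (A + B)); lra).
  set (r := sqrt D).
  assert (Hr : r * r = D) by (apply sqrt_sqrt; assumption).
  assert (Hr0 : A + B <= r).
  { destruct (Rle_dec (A + B) 0).
    - pose proof (sqrt_pos D); unfold r; lra.
    - unfold r; rewrite <- (sqrt_pow2 (A + B)) by lra.
      apply sqrt_le_1_alt; assumption. }
  exists ((- B + r) / A); split.
  - apply Rmult_le_reg_r with A; [assumption|].
    unfold Rdiv; rewrite Rmult_assoc, Rinv_l by lra; lra.
  - set (s := (- B + r) / A).
    assert (Hs : s * A = - B + r) by (unfold s; field; lra).
    assert (Hq : (s ^ 2 * A + 2 * s * B + normsq a - 1) * A = 0).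
    { transitivity ((s * A) ^ 2 + 2 * (s * A) * B + A * (normsq a - 1)); [ring|].
      rewrite Hs. unfold D in Hr. nra. }
    apply Rmult_integral in Hq as [Hq|Hq]; [|lra].
    unfold normsq, A, B in *; simpl fst; simpl snd; fold dx dy; lra.
Qed.

(** With z = (x, y) and z' = (x', y'), the orientation is y (1 - x') - y' (1 - x), a comparison of
    slopes of chords ending at (1, 0). Both products are nonnegative, so their squares can be
    compared and the ordinates eliminated. *)
Lemma upper_arc_orient (z z' : point) :
  normsq z = 1 -> normsq z' = 1 -> 0 <= snd z -> 0 <= snd z' ->
  fst z' < fst z -> fst z < 1 -> 0 < orient z' (1, 0) z.
Proof.
  destruct z as [x y], z' as [x' y']; unfold normsq, orient; simpl.
  intros Hz Hz' Hy Hy' Hlt H1.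
  assert (H : y' * (1 - x) < y * (1 - x')).
  { apply Rnot_le_lt; intros H.
    assert ((y * (1 - x')) * (y * (1 - x')) <= (y' * (1 - x)) * (y' * (1 - x)))
      by (apply Rmult_le_compat; nra).
    assert (-1 <= x') by nra.
    (* This product is the difference of the two squares after y^2 = 1 - x^2 and y'^2 = 1 - x'^2. *)
    assert (0 < (1 - x) * (1 - x') * (2 * (x - x'))) by (repeat apply Rmult_lt_0_compat; lra).
    replace (y * (1 - x') * (y * (1 - x'))) with ((1 - x * x) * (1 - x') ^ 2) in * by nra.
    replace (y' * (1 - x) * (y' * (1 - x))) with ((1 - x' * x') * (1 - x) ^ 2) in * by nra.
    nra. }
  lra.
Qed.

(** The ray from [a] turns clockwise from [z] to [z'] and stops short of (1, 0), so its exit point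
    slides along the upper arc towards (1, 0). *)
Lemma rotating_ray_hits (a z z' : point) :
  normsq a <= 1 -> 0 <= snd a ->
  normsq z = 1 -> 0 <= snd z -> normsq z' = 1 ->
  orient a z z' <= 0 -> orient a z' (1, 0) < 0 ->
  0 <= snd z' /\ fst z <= fst z'.
Proof.
  intros Ha Hay Hz Hzy Hz' Ho Hv.
  pose proof (normsq_le_1_fst a ltac:(lra)).
  pose proof (normsq_le_1_fst z ltac:(lra)).
  pose proof (normsq_le_1_fst z' ltac:(lra)).
  assert (Hy' : 0 <= snd z').
  { unfold orient in Hv; simpl in Hv.
    apply Rnot_lt_le; intros Hneg.
    assert (0 <= snd a * (1 - fst z')) by (apply Rmult_le_pos; lra).
    assert (0 <= - snd z' * (1 - fst a)) by (apply Rmult_le_pos; lra).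
    lra. }
  split; [assumption|].
  apply Rnot_lt_le; intros Hlt.
  destruct (Rlt_dec (fst z) 1) as [Hz1|Hz1].
  - pose proof (upper_arc_orient z z' Hz Hz' Hzy Hy' Hlt Hz1) as HK.
    (* [a] lies in the cone opposite to [z, (1,0)] at [z'], which meets the disk only in [z'] *)
    set (K := orient z' (1, 0) z) in *.
    (* The linear relation between the vectors from [a], [z] and (1, 0) to [z'], multiplied by [z']
       as a scalar product. The left side is nonnegative since [a] is in the disk; the right side is
       negative. *)
    assert (E : K * (normsq z' - (fst a * fst z' + snd a * snd z'))
      = orient a z' (1, 0) * (normsq z' - (fst z * fst z' + snd z * snd z'))
        + orient a z z' * (normsq z' - fst z'))
      by (unfold K, orient, normsq; simpl; ring).
    assert (fst a * fst z' + snd a * snd z' <= 1).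
    { pose proof (pow2_ge_0 (fst a - fst z')); pose proof (pow2_ge_0 (snd a - snd z')).
      unfold normsq in Ha, Hz'; lra. }
    assert (fst z * fst z' + snd z * snd z' < 1).
    { assert (0 < (fst z - fst z') ^ 2) by nra.
      pose proof (pow2_ge_0 (snd z - snd z')).
      unfold normsq in Hz, Hz'; lra. }
    rewrite Hz' in E.
    assert (0 <= K * (1 - (fst a * fst z' + snd a * snd z')))
      by (apply Rmult_le_pos; lra).
    assert (0 < - orient a z' (1, 0) * (1 - (fst z * fst z' + snd z * snd z')))
      by (apply Rmult_lt_0_compat; lra).
    assert (0 <= - orient a z z' * (1 - fst z')) by (apply Rmult_le_pos; lra).
    lra.
  (* Here the two orientation hypotheses concern the same triangle with opposite signs. *)
  - assert (Ez : z = (1, 0)).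
    { unfold normsq in Hz; destruct z as [x y]; simpl in *; f_equal; nra. }
    subst z; unfold orient in *; simpl in *; lra.
Qed.

Lemma last_default {A} (l : list A) : forall x a b, last (x :: l) a = last (x :: l) b.
Proof. induction l as [|y l IH]; intros; [reflexivity | apply (IH y)]. Qed.

Lemma clockwise_cons_tail a l : clockwise (a :: l) -> clockwise l.
Proof. apply clockwise_subseq; constructor; apply subseq_refl. Qed.

(* [z] is the point where the ray along the edge just before [a] leaves the disk. Turning
   the ray at [a] moves it along the circle by an arc longer than the chord [z z'], so
   length so far + |a z| + (arc from [z] to (1, 0)) never increases. *)
Lemma walk_length_le_arc (l : list point) : forall a z : point,
  l <> [] -> last l a = (1, 0) ->
  normsq a <= 1 -> 0 <= snd a -> normsq z = 1 -> 0 <= snd z ->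
  Forall (fun b => normsq b <= 1 /\ 0 <= snd b /\ orient a z b <= 0) l ->
  clockwise (a :: l) ->
  walk_length a l <= dist a z + acos (fst z).
Proof.
  induction l as [|b l IH]; intros a z Hne Hlast Ha Hay Hz Hzy Hall Hcw; [easy|].
  inversion Hall as [|? ? (Hb & Hby & Hob) Hall']; subst; clear Hall.
  pose proof (normsq_le_1_fst z ltac:(lra)).
  destruct l as [|c l].
  - simpl in Hlast; subst b; simpl.
    assert (Hv : normsq (1, 0) = 1) by (unfold normsq; simpl; ring).
    pose proof (chord_le_arc z (1, 0) Hz Hv Hzy ltac:(simpl; lra) ltac:(simpl; lra)) as Hc.
    simpl fst in Hc at 2; rewrite acos_1 in Hc.
    pose proof (dist_triangle a z (1, 0)); lra.
  - assert (Hv : orient a b (1, 0) < 0).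
    { apply Hcw. do 2 constructor. apply subseq_single.
      rewrite <- Hlast. change (last (b :: c :: l) a) with (last (c :: l) a).
      clear; revert c; induction l as [|d l IH]; intros c; [now left|].
      right; apply IH. }
    assert (Hab : a <> b) by (intros ->; unfold orient in Hv; lra).
    destruct (ray_hits_circle a b Ha Hb Hab) as (s & Hs & Hz').
    (* The exit point of the edge from [a] to [b]; since s >= 1, [b] lies between [a] and [z']. *)
    set (z' := (fst a + s * (fst b - fst a), snd a + s * (snd b - snd a))) in *.
    assert (Ho : orient a z z' = s * orient a z b) by (unfold orient, z'; simpl; ring).
    assert (Ho' : orient a z' (1, 0) = s * orient a b (1, 0))
      by (unfold orient, z'; simpl; ring).
    destruct (rotating_ray_hits a z z') as (Hy' & Hle); auto; try nra.
    assert (Hd1 : dist a b + dist b z' = dist a z').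
    { apply dist_segment with (/ s).
      - split; [left; apply Rinv_0_lt_compat; lra|].
        rewrite <- Rinv_1; apply Rinv_le_contravar; lra.
      - unfold z'; simpl; field; lra.
      - unfold z'; simpl; field; lra. }
    assert (IHl : walk_length b (c :: l) <= dist b z' + acos (fst z')).
    { apply IH; auto.
      - discriminate.
      - rewrite <- Hlast. change (last (b :: c :: l) a) with (last (c :: l) a).
        apply last_default.
      - rewrite Forall_forall in *; intros d Hd; specialize (Hall' d Hd).
        repeat split; try tauto.
        assert (orient a b d < 0)
          by (apply Hcw; do 2 constructor; apply subseq_single; assumption).
        replace (orient b z' d) with ((s - 1) * orient a b d)
          by (unfold orient, z'; simpl; ring).
        nra.
      - apply clockwise_cons_tail with a; assumption. }
    (* Balance of the potential: |ab| + |bz'| = |az'| <= |az| + |zz'|, and |zz'| is at most the arc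
       that is given up. *)
    pose proof (chord_le_arc z z' Hz Hz' Hzy Hy' Hle).
    pose proof (dist_triangle a z z').
    change (walk_length a (b :: c :: l)) with (dist a b + walk_length b (c :: l)); lra.
Qed.

(** Right angles count. By Thales, [b] lies in the closed disk with diameter [a c]. *)
Definition obtuse (a b c : point) : Prop :=
  (fst a - fst b) * (fst c - fst b) + (snd a - snd b) * (snd c - snd b) <= 0.

Lemma subseq_map {A B} (f : A -> B) L : forall l,
  subseq l (map f L) -> exists l', l = map f l' /\ subseq l' L.
Proof.
  induction L as [|x L IH]; simpl; intros l H;
    inversion H as [|? l0 ? H0|? ? ? H0]; subst.
  - exists []; repeat constructor.
  - exists []; repeat constructor.
  - destruct (IH _ H0) as (l' & -> & H'); exists (x :: l'); repeat constructor; assumption.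
  - destruct (IH _ H0) as (l' & -> & H'); exists l'; repeat constructor; assumption.
Qed.

(** A similarity normalises [u], [v] to (-1, 0), (1, 0). The angle condition then places the chain
    in the unit disk, and the right turns place it above the axis. *)
Lemma convex_chain_length u v l :
  u <> v ->
  clockwise (u :: l ++ [v]) ->
  (forall w, In w l -> obtuse u w v) ->
  walk_length u (l ++ [v]) <= PI / 2 * dist u v.
Proof.
  intros Huv Hcw Hob.
  set (hx := (fst v - fst u) / 2); set (hy := (snd v - snd u) / 2).
  set (cx := (fst v + fst u) / 2); set (cy := (snd v + snd u) / 2).
  set (m := hx ^ 2 + hy ^ 2).
  assert (Hm : 0 < m).
  { destruct (Req_dec hx 0); [destruct (Req_dec hy 0)|].
    - exfalso; apply Huv; destruct u, v; simpl in *; f_equal; unfold hx, hy in *; simpl in *; lra.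
    - unfold m; nra.
    - unfold m; nra. }
  (* Division by the complex number hx + i hy after moving the midpoint of [u v] to the origin;
     lengths shrink by [sqrt m] and orientations by [m]. *)
  set (T := fun w : point =>
    (((fst w - cx) * hx + (snd w - cy) * hy) / m,
     (hx * (snd w - cy) - hy * (fst w - cx)) / m)).
  assert (Tu : T u = (-1, 0)).
  { unfold T; f_equal; apply Rmult_eq_reg_r with m; try lra;
      unfold Rdiv; rewrite Rmult_assoc, Rinv_l by lra; unfold m, hx, hy, cx, cy; field. }
  assert (Tv : T v = (1, 0)).
  { unfold T; f_equal; apply Rmult_eq_reg_r with m; try lra;
      unfold Rdiv; rewrite Rmult_assoc, Rinv_l by lra; unfold m, hx, hy, cx, cy; field. }
  assert (To : forall a b c, orient (T a) (T b) (T c) = orient a b c / m).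
  { intros a b c; unfold orient, T; simpl fst; simpl snd.
    unfold m; field; fold m; lra. }
  assert (Td : forall a b, dist a b = sqrt m * dist (T a) (T b)).
  { intros a b; apply dist_scale; [apply sqrt_pos|].
    rewrite pow2_sqrt by lra.
    unfold T; simpl fst; simpl snd; unfold m; field; fold m; lra. }
  assert (Tw : forall l' a, walk_length a l' = sqrt m * walk_length (T a) (map T l')).
  { induction l' as [|b l' IH]; intros a; simpl; [ring|]. rewrite IH, (Td a b); ring. }
  rewrite Tw, map_app, Td, Tu, Tv; simpl map; rewrite Tv.
  replace (PI / 2 * (sqrt m * dist (-1, 0) (1, 0))) with (sqrt m * PI).
  2:{ replace (dist (-1, 0) (1, 0)) with 2; [field|].
      unfold dist; simpl fst; simpl snd.
      replace ((-1 - 1) ^ 2 + (0 - 0) ^ 2) with (2 ^ 2) by ring.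
      rewrite sqrt_pow2; lra. }
  apply Rmult_le_compat_l; [apply sqrt_pos|].
  (* No edge precedes [u], so the first exit point is [u] itself and the whole semicircle lies
     ahead. *)
  replace PI with (dist (-1, 0) (-1, 0) + acos (fst (-1, 0))).
  2:{ rewrite dist_refl; simpl. replace (-1) with (- (1)) by ring.
      rewrite acos_opp, acos_1; ring. }
  apply walk_length_le_arc; try (unfold normsq; simpl; lra).
  - now destruct (map T l).
  - apply last_last.
  - apply Forall_app; split.
    + apply Forall_map, Forall_forall; intros w Hw.
      assert (Ho : orient u w v < 0).
      { apply Hcw; constructor.
        apply (subseq_app [w] [v]); [now apply subseq_single | apply subseq_refl]. }
      specialize (Hob w Hw).
      repeat split.
      * assert (E : 1 - normsq (T w) = - ((fst u - fst w) * (fst v - fst w)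
          + (snd u - snd w) * (snd v - snd w)) / m).
        { transitivity ((m - ((fst w - cx) ^ 2 + (snd w - cy) ^ 2)) / m).
          - unfold normsq, T; simpl fst; simpl snd; unfold m; field; fold m; lra.
          - f_equal; unfold m, hx, hy, cx, cy; field. }
        unfold obtuse in Hob.
        assert (0 <= - ((fst u - fst w) * (fst v - fst w)
          + (snd u - snd w) * (snd v - snd w)) / m)
          by (apply Rmult_le_pos; [lra | left; apply Rinv_0_lt_compat; assumption]).
        lra.
      * unfold T; simpl. apply Rmult_le_pos; [|left; apply Rinv_0_lt_compat; assumption].
        replace (hx * (snd w - cy) - hy * (fst w - cx)) with (- orient u w v / 2)
          by (unfold orient, hx, hy, cx, cy; field).
        lra.
      * unfold orient; simpl; lra.
    + constructor; [|constructor]. unfold normsq, orient; simpl; lra.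
  - rewrite <- Tu, <- Tv.
    intros a b c H.
    change (subseq [a; b; c] (map T [u] ++ map T l ++ map T [v])) in H.
    rewrite <- !map_app in H.
    apply subseq_map in H as (l' & E & H).
    destruct l' as [|a' [|b' [|c' [|]]]]; try discriminate.
    injection E as -> -> ->. rewrite To.
    assert (orient a' b' c' < 0) by (apply Hcw; exact H).
    pose proof (Rinv_0_lt_compat m Hm). unfold Rdiv; nra.
Qed.

(** * Convex position seen from the line through p and -p *)

(** [along] and [across] are coordinates in the frame of [p], scaled by |p| to avoid square roots.
    Passing to [pneg p] flips both signs, so each lemma on the upper side also serves the lower
    one. *)
Definition along (p u : point) : R := fst p * fst u + snd p * snd u.
Definition across (p u : point) : R := fst p * snd u - snd p * fst u.

Definition farthest (S : list point) (p : point) : Prop :=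
  In p S /\ In (pneg p) S /\ 0 < normsq p /\ forall x, In x S -> normsq x <= normsq p.

Lemma pneg_involutive p : pneg (pneg p) = p.
Proof. destruct p; unfold pneg; simpl; f_equal; ring. Qed.

Lemma farthest_pneg S p : farthest S p -> farthest S (pneg p).
Proof.
  assert (E : normsq (pneg p) = normsq p) by (unfold normsq, pneg; simpl; ring).
  intros (Hp & Hp' & H0 & Hmax); repeat split; try rewrite E; auto.
  now rewrite pneg_involutive.
Qed.

Lemma along_pneg p u : along (pneg p) u = - along p u.
Proof. unfold along, pneg; simpl; ring. Qed.

Lemma across_pneg p u : across (pneg p) u = - across p u.
Proof. unfold across, pneg; simpl; ring. Qed.

Lemma along_across_inj p a b :
  0 < normsq p -> along p a = along p b -> across p a = across p b -> a = b.
Proof.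
  intros Hp Ha Hc.
  assert (E1 : normsq p * (fst a - fst b)
    = fst p * (along p a - along p b) - snd p * (across p a - across p b))
    by (unfold normsq, along, across; ring).
  assert (E2 : normsq p * (snd a - snd b)
    = snd p * (along p a - along p b) + fst p * (across p a - across p b))
    by (unfold normsq, along, across; ring).
  rewrite Ha, Hc in E1, E2.
  destruct a, b; simpl in *; f_equal; nra.
Qed.

Lemma along_across_orient p a b c :
  normsq p * orient a b c
    = (along p b - along p a) * (across p c - across p a)
      - (across p b - across p a) * (along p c - along p a).
Proof. unfold normsq, orient, along, across; ring. Qed.

Lemma along_self p : along p p = normsq p.
Proof. unfold along, normsq; ring. Qed.

Lemma across_self p : across p p = 0.
Proof. unfold across; ring. Qed.

Lemma along_opp p : along p (pneg p) = - normsq p.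
Proof. unfold along, normsq, pneg; simpl; ring. Qed.

Lemma across_opp p : across p (pneg p) = 0.
Proof. unfold across, pneg; simpl; ring. Qed.

Lemma along_across_normsq p u :
  along p u ^ 2 + across p u ^ 2 = normsq p * normsq u.
Proof. unfold along, across, normsq; ring. Qed.

Lemma farthest_along S p x :
  farthest S p -> In x S -> - normsq p <= along p x <= normsq p.
Proof.
  intros (_ & _ & H0 & Hmax) Hx; specialize (Hmax x Hx).
  pose proof (along_across_normsq p x); pose proof (pow2_ge_0 (across p x)).
  assert (normsq p * normsq x <= normsq p * normsq p) by (apply Rmult_le_compat_l; lra).
  split; nra.
Qed.

Lemma farthest_along_eq S p x :
  farthest S p -> In x S -> along p x = normsq p -> x = p.
Proof.
  intros (_ & _ & H0 & Hmax) Hx E; specialize (Hmax x Hx).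
  pose proof (along_across_normsq p x) as H; rewrite E in H.
  assert (normsq p * normsq x <= normsq p * normsq p) by (apply Rmult_le_compat_l; lra).
  apply (along_across_inj p); auto.
  - now rewrite along_self.
  - rewrite across_self; nra.
Qed.

Lemma farthest_along_eq_opp S p x :
  farthest S p -> In x S -> along p x = - normsq p -> x = pneg p.
Proof.
  intros Hp Hx E; apply (farthest_along_eq S).
  - now apply farthest_pneg.
  - assumption.
  - rewrite along_pneg, E; unfold normsq, pneg; simpl; ring.
Qed.

Lemma farthest_along_lt S p x :
  farthest S p -> In x S -> x <> p -> along p x < normsq p.
Proof.
  intros Hp Hx Hne. pose proof (farthest_along S p x Hp Hx).
  destruct (Req_dec (along p x) (normsq p)) as [E|]; [|lra].
  exfalso; apply Hne; eapply farthest_along_eq; eassumption.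
Qed.

Lemma farthest_along_gt S p x :
  farthest S p -> In x S -> x <> pneg p -> - normsq p < along p x.
Proof.
  intros Hp Hx Hne. pose proof (farthest_along S p x Hp Hx).
  destruct (Req_dec (along p x) (- normsq p)) as [E|]; [|lra].
  exfalso; apply Hne; eapply farthest_along_eq_opp; eassumption.
Qed.

(** The line through [w] perpendicular to [p] meets the segment [u v] in [z] and the segment from -p
    to p in [b]. A [w] between [b] and [z] is in the hull of the other points. All uses of
    [convex_position] pass through here. *)
Lemma not_under_segment S p u v w t :
  convex_position S -> farthest S p -> In u S -> In v S -> In w S ->
  w <> u -> w <> v -> w <> p -> w <> pneg p ->
  0 <= t <= 1 -> along p w = (1 - t) * along p u + t * along p v ->
  0 <= across p w -> across p w <= (1 - t) * across p u + t * across p v -> False.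
Proof.
  intros Hc Hp Hu Hv Hw Hwu Hwv Hwp Hwp' Ht Ha H0 H1.
  pose proof (farthest_along S p w Hp Hw) as Hb.
  destruct Hp as (HpS & HpS' & Hn & _).
  apply (Hc w Hw).
  assert (Hin : forall x, In x S -> w <> x -> in_conv_hull (remove point_eq_dec w S) x)
    by (intros; apply in_conv_hull_In, in_in_remove; auto).
  set (z := ((1 - t) * fst u + t * fst v, (1 - t) * snd u + t * snd v)).
  set (m := (along p w + normsq p) / (2 * normsq p)).
  set (b := ((1 - m) * fst (pneg p) + m * fst p, (1 - m) * snd (pneg p) + m * snd p)).
  assert (Hm : 0 <= m <= 1).
  { assert (E : m * (2 * normsq p) = along p w + normsq p) by (unfold m; field; lra).
    split; nra. }
  assert (Hz : in_conv_hull (remove point_eq_dec w S) z).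
  { apply in_conv_hull_segment with u v; auto; exists t; auto. }
  assert (Hb' : in_conv_hull (remove point_eq_dec w S) b).
  { apply in_conv_hull_segment with (pneg p) p; auto; exists m; auto. }
  assert (Az : along p z = along p w) by (rewrite Ha; unfold along, z; simpl; ring).
  assert (Cz : across p z = (1 - t) * across p u + t * across p v)
    by (unfold across, z; simpl; ring).
  assert (Ab : along p b = along p w).
  { transitivity ((2 * m - 1) * normsq p).
    - unfold along, b, pneg, normsq; simpl; ring.
    - unfold m; field; lra. }
  assert (Cb : across p b = 0) by (unfold across, b, pneg; simpl; ring).
  rewrite <- Cz in H1.
  (* If [z] is on the axis, then [z] and [b] coincide, [w] has height 0, and any [s] would do. *)
  assert (Hs : exists s, 0 <= s <= 1 /\ across p w = s * across p z).
  { destruct (Req_dec (across p z) 0) as [E|E].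
    - exists 0; lra.
    - exists (across p w / across p z).
      assert (Es : across p w / across p z * across p z = across p w) by (field; lra).
      split; [split; nra | lra]. }
  destruct Hs as (s & Hs & Es).
  apply in_conv_hull_segment with b z; auto.
  exists s; split; [assumption|].
  assert (E : w = ((1 - s) * fst b + s * fst z, (1 - s) * snd b + s * snd z)).
  { apply (along_across_inj p); [assumption| |].
    - transitivity ((1 - s) * along p b + s * along p z).
      + rewrite Ab, Az; ring.
      + unfold along; simpl; ring.
    - transitivity ((1 - s) * across p b + s * across p z).
      + rewrite Cb, Es; ring.
      + unfold across; simpl; ring. }
  split; [exact (f_equal fst E) | exact (f_equal snd E)].
Qed.

(** Without a right turn, [w] would be on or below the chord [u v], against [not_under_segment]. *)
Lemma upper_orient S p u w v :
  convex_position S -> farthest S p -> In u S -> In w S -> In v S ->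
  0 <= across p u -> 0 <= across p w -> 0 <= across p v ->
  along p u < along p w -> along p w < along p v -> orient u w v < 0.
Proof.
  intros Hc Hp Hu Hw Hv Cu Cw Cv H1 H2.
  apply Rnot_le_lt; intros Ho.
  pose proof (farthest_along S p u Hp Hu); pose proof (farthest_along S p v Hp Hv).
  pose proof (along_across_orient p u w v) as E.
  assert (0 <= normsq p * orient u w v)
    by (apply Rmult_le_pos; [destruct Hp as (_ & _ & ? & _)|]; lra).
  set (t := (along p w - along p u) / (along p v - along p u)).
  assert (Et : t * (along p v - along p u) = along p w - along p u)
    by (unfold t; field; lra).
  assert (Ht : 0 <= t <= 1) by (split; nra).
  apply (not_under_segment S p u v w t); auto; try (intros ->); try lra.
  - rewrite along_self in *; lra.
  - rewrite along_opp in *; lra.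
  - rewrite <- Et in E.
    assert (0 <= (along p v - along p u)
      * ((1 - t) * across p u + t * across p v - across p w)) by lra.
    nra.
Qed.

Lemma upper_along_inj S p u v :
  convex_position S -> farthest S p -> In u S -> In v S ->
  0 <= across p u -> 0 <= across p v -> along p u = along p v -> u = v.
Proof.
  intros Hc Hp.
  assert (H : forall u v, In u S -> In v S -> 0 <= across p u -> 0 <= across p v ->
    along p u = along p v -> across p u <= across p v -> u = v).
  { intros u' v' Hu Hv Cu Cv E Hle.
    destruct (point_eq_dec u' v') as [|Hne]; [assumption|exfalso].
    assert (Hup : u' <> p).
    { intros ->; apply Hne; symmetry; apply (farthest_along_eq S); auto.
      now rewrite <- E, along_self. }
    assert (Hup' : u' <> pneg p).
    { intros ->; apply Hne; symmetry; apply (farthest_along_eq_opp S); auto.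
      now rewrite <- E, along_opp. }
    (* The lower of two points with equal [along] lies under the degenerate segment formed by the
       upper one. *)
    apply (not_under_segment S p v' v' u' 0); auto; lra. }
  intros Hu Hv Cu Cv E.
  destruct (Rle_dec (across p u) (across p v)); [auto | symmetry; apply H; auto; lra].
Qed.

Lemma across_eq_0 S p c :
  convex_position S -> farthest S p -> In c S -> across p c = 0 -> c = p \/ c = pneg p.
Proof.
  intros Hc Hp HcS E.
  destruct (point_eq_dec c p) as [|H1]; [now left|].
  destruct (point_eq_dec c (pneg p)) as [|H2]; [now right|exfalso].
  pose proof (farthest_along S p c Hp HcS).
  pose proof Hp as (HpS & HpS' & Hn & _).
  assert (Em : (along p c + normsq p) / (2 * normsq p) * (2 * normsq p)
    = along p c + normsq p) by (field; lra).
  apply (not_under_segment S p (pneg p) p c ((along p c + normsq p) / (2 * normsq p)));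
    auto; try rewrite along_self, along_opp; try rewrite across_self, across_opp; try lra.
  split; nra.
Qed.

(** By [upper_orient] the line [a b] passes on or above both -p and p, hence above the segment
    joining them, and [c] is strictly below that segment unless it is one of its ends. *)
Lemma upper_lower_orient S p a b c :
  convex_position S -> farthest S p -> In a S -> In b S -> In c S ->
  0 <= across p a -> 0 <= across p b -> across p c <= 0 ->
  along p a < along p b -> c <> a -> c <> b -> orient a b c < 0.
Proof.
  intros Hc Hp Ha Hb HcS Ca Cb Cc Hab Hca Hcb.
  pose proof Hp as (HpS & HpS' & Hn & _).
  pose proof (across_self p) as C1; pose proof (across_opp p) as C2.
  assert (Fp : b <> p -> orient a b p < 0).
  { intros Hne; apply (upper_orient S p); auto; try lra.
    rewrite along_self; apply (farthest_along_lt S); auto. }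
  assert (Fq : a <> pneg p -> orient a b (pneg p) < 0).
  { intros Hne; rewrite <- orient_rot; apply (upper_orient S p); auto; try lra.
    rewrite along_opp; apply (farthest_along_gt S); auto. }
  destruct (Req_dec (across p c) 0) as [E|E].
  - destruct (across_eq_0 S p c Hc Hp HcS E) as [->| ->]; auto.
  - assert (Fp' : normsq p * orient a b p <= 0).
    { destruct (point_eq_dec b p) as [->|Hne].
      - unfold orient; lra.
      - specialize (Fp Hne); nra. }
    assert (Fq' : normsq p * orient a b (pneg p) <= 0).
    { destruct (point_eq_dec a (pneg p)) as [->|Hne].
      - unfold orient; lra.
      - specialize (Fq Hne); nra. }
    rewrite along_across_orient in Fp', Fq'.
    rewrite along_self, across_self in Fp'; rewrite along_opp, across_opp in Fq'.
    pose proof (farthest_along S p c Hp HcS).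
    pose proof (along_across_orient p a b c) as Eo.
    assert ((along p b - along p a) * across p c < 0) by nra.
    (* Up to a factor, the orientation of [a], [b] and the foot of [c] on the axis. It is affine in
       [along p c] and nonpositive at both ends. *)
    assert ((along p b - along p a) * (0 - across p a)
      - (across p b - across p a) * (along p c - along p a) <= 0).
    { destruct (Rle_dec 0 (across p b - across p a)); nra. }
    apply Rnot_le_lt; intros Ho.
    assert (0 <= normsq p * orient a b c) by (apply Rmult_le_pos; lra).
    lra.
Qed.

Lemma upper_obtuse S p u w v :
  convex_position S -> farthest S p -> In u S -> In w S -> In v S ->
  0 <= across p u -> 0 <= across p w -> 0 <= across p v ->
  along p u < along p w -> along p w < along p v -> obtuse u w v.
Proof.
  intros Hc Hp Hu Hw Hv Cu Cw Cv H1 H2.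
  pose proof Hp as (HpS & HpS' & Hn & Hmax).
  pose proof (across_self p) as C1; pose proof (across_opp p) as C2.
  pose proof (along_self p) as A1; pose proof (along_opp p) as A2.
  pose proof (farthest_along S p u Hp Hu); pose proof (farthest_along S p v Hp Hv).
  assert (Ha : 0 < orient w (pneg p) v).
  { assert (orient (pneg p) w v < 0) by (apply (upper_orient S p); auto; lra).
    unfold orient in *; lra. }
  assert (Hd : 0 < orient w u p).
  { assert (orient u w p < 0) by (apply (upper_orient S p); auto; lra).
    unfold orient in *; lra. }
  assert (Hk : 0 < orient w u v).
  { assert (orient u w v < 0) by (apply (upper_orient S p); auto; lra).
    unfold orient in *; lra. }
  assert (Hb : 0 <= orient w u (pneg p)).
  { destruct (point_eq_dec u (pneg p)) as [->|Hne]; [unfold orient; lra|].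
    pose proof (farthest_along_gt S p u Hp Hu Hne).
    assert (orient (pneg p) u w < 0) by (apply (upper_orient S p); auto; lra).
    unfold orient in *; lra. }
  assert (Hg : 0 <= orient w p v).
  { destruct (point_eq_dec v p) as [->|Hne]; [unfold orient; lra|].
    pose proof (farthest_along_lt S p v Hp Hv Hne).
    assert (orient w v p < 0) by (apply (upper_orient S p); auto; lra).
    unfold orient in *; lra. }
  (* [p - w] and [-p - w] lie in the cone spanned by [u - w] and [v - w], and their
     inner product is [|w|^2 - |p|^2 <= 0]. *)
  unfold obtuse; apply Rnot_lt_le; intros Hpos.
  set (UV := (fst u - fst w) * (fst v - fst w) + (snd u - snd w) * (snd v - snd w)) in *.
  (* By Cramer's rule, [orient w u v] times p - w has coefficients [orient w p v] and [orient w u p]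
     on u - w and v - w, and similarly for -p - w. [E] is the scalar product of the two
     expansions. *)
  assert (E : orient w u v ^ 2 * (normsq w - normsq p)
    = orient w (pneg p) v * orient w p v * ((fst u - fst w) ^ 2 + (snd u - snd w) ^ 2)
      + (orient w (pneg p) v * orient w u p + orient w u (pneg p) * orient w p v) * UV
      + orient w u (pneg p) * orient w u p * ((fst v - fst w) ^ 2 + (snd v - snd w) ^ 2)).
  { unfold UV, orient, normsq, pneg; simpl fst; simpl snd; ring. }
  specialize (Hmax w Hw).
  assert (0 <= orient w u v ^ 2 * (normsq p - normsq w))
    by (apply Rmult_le_pos; [apply pow2_ge_0 | lra]).
  assert (0 < orient w (pneg p) v * orient w u p * UV)
    by (repeat apply Rmult_lt_0_compat; assumption).
  assert (0 <= orient w u (pneg p) * orient w p v * UV)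
    by (repeat apply Rmult_le_pos; lra).
  assert (0 <= orient w (pneg p) v * orient w p v
    * ((fst u - fst w) ^ 2 + (snd u - snd w) ^ 2))
    by (repeat apply Rmult_le_pos; try lra; apply Rplus_le_le_0_compat; apply pow2_ge_0).
  assert (0 <= orient w u (pneg p) * orient w u p
    * ((fst v - fst w) ^ 2 + (snd v - snd w) ^ 2))
    by (repeat apply Rmult_le_pos; try lra; apply Rplus_le_le_0_compat; apply pow2_ge_0).
  lra.
Qed.

(** [keep] is a parameter because the chains are not treated alike: p and -p, which lie on the line,
    must go to only one of them. *)
Lemma exists_upper_chain S p (keep : point -> bool) :
  NoDup S -> convex_position S -> farthest S p ->
  (forall x, keep x = true -> 0 <= across p x) ->
  exists L, Permutation (filter keep S) L /\
    forall x y l, subseq (x :: y :: l) L -> along p x < along p y.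
Proof.
  intros Hnd Hc Hp Hk.
  destruct (exists_StronglySorted (along p) (filter keep S)) as (L & HP & HS).
  - now apply NoDup_filter.
  - intros x y Hx Hy E; apply filter_In in Hx as [], Hy as [].
    apply (upper_along_inj S p); auto.
  - exists L; split; [assumption|]. intros x y l H.
    exact (subseq_StronglySorted _ _ _ _ _ HS H).
Qed.

(** [L1] runs from -p to p on the upper side. [L2] is sorted by [along (pneg p)] and so runs back
    below, which makes the concatenation a clockwise tour. *)
Lemma exists_clockwise_order S p :
  NoDup S -> convex_position S -> farthest S p ->
  exists L1 L2, Permutation S (L1 ++ L2) /\ clockwise (L1 ++ L2) /\
    (forall a b c, subseq [a; b; c] L1 -> obtuse a b c) /\
    (forall a b c, subseq [a; b; c] L2 -> obtuse a b c).
Proof.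
  intros Hnd Hc Hp.
  set (up := fun x => if Rle_dec 0 (across p x) then true else false).
  assert (Hup : forall x, up x = true <-> 0 <= across p x)
    by (intros x; unfold up; destruct Rle_dec; split; intros; auto; discriminate).
  assert (Hup' : forall x, negb (up x) = true <-> across p x < 0)
    by (intros x; unfold up; destruct Rle_dec; simpl; split; intros; auto; try discriminate; lra).
  pose proof (farthest_pneg S p Hp) as Hq.
  destruct (exists_upper_chain S p up) as (L1 & P1 & S1); auto.
  { intros x; apply Hup. }
  destruct (exists_upper_chain S (pneg p) (fun x => negb (up x))) as (L2 & P2 & S2); auto.
  { intros x Hx; rewrite across_pneg; apply Hup' in Hx; lra. }
  assert (I1 : forall x, In x L1 -> In x S /\ 0 <= across p x).
  { intros x Hx; apply (Permutation_in _ (Permutation_sym P1)) in Hx.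
    apply filter_In in Hx as [? Hx]; split; [|apply Hup]; assumption. }
  assert (I2 : forall x, In x L2 -> In x S /\ across p x < 0).
  { intros x Hx; apply (Permutation_in _ (Permutation_sym P2)) in Hx.
    apply filter_In in Hx as [? Hx]; split; [|apply Hup']; assumption. }
  assert (T1 : forall a b c, subseq [a; b; c] L1 ->
    (In a L1 /\ In b L1 /\ In c L1) /\ along p a < along p b /\ along p b < along p c).
  { intros a b c H; split; [repeat split; apply (subseq_incl _ _ _ H); simpl; auto|].
    split; [exact (S1 _ _ _ H)|].
    apply (S1 b c []); eapply subseq_trans; [|exact H]; repeat constructor. }
  assert (T2 : forall a b c, subseq [a; b; c] L2 ->
    (In a L2 /\ In b L2 /\ In c L2) /\ along (pneg p) a < along (pneg p) b /\
    along (pneg p) b < along (pneg p) c).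
  { intros a b c H; split; [repeat split; apply (subseq_incl _ _ _ H); simpl; auto|].
    split; [exact (S2 _ _ _ H)|].
    apply (S2 b c []); eapply subseq_trans; [|exact H]; repeat constructor. }
  assert (J2 : forall x, In x L2 -> In x S /\ 0 <= across (pneg p) x).
  { intros x Hx; rewrite across_pneg; destruct (I2 x Hx); split; [assumption|lra]. }
  exists L1, L2; repeat split.
  - rewrite <- P1, <- P2. clear.
    induction S as [|x S IH]; simpl; [constructor|].
    destruct (up x); simpl.
    + now constructor.
    + now apply Permutation_cons_app.
  - intros a b c H; apply subseq_app_inv in H as (l1 & l2 & E & H1 & H2).
    (* Cases by how many of the three points lie in [L1]. With exactly one, the triple is rotated
       and the picture is turned by replacing p with -p. *)
    destruct l1 as [|a1 [|b1 [|c1 [|]]]]; simpl in E.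
    + subst l2; apply T2 in H2 as ((Ha & Hb & Hc') & Hab & Hbc).
      apply J2 in Ha as [], Hb as [], Hc' as [].
      apply (upper_orient S (pneg p)); auto.
    + injection E as <- <-.
      assert (Ha : In a L1) by (apply (subseq_incl _ _ a H1); simpl; auto).
      assert (Hb : In b L2) by (apply (subseq_incl _ _ b H2); simpl; auto).
      assert (Hc' : In c L2) by (apply (subseq_incl _ _ c H2); simpl; auto).
      apply I1 in Ha as [? Ca].
      pose proof (I2 _ Hb) as [? ?]; pose proof (I2 _ Hc') as [? ?].
      rewrite orient_rot. apply (upper_lower_orient S (pneg p)); auto;
        try (rewrite across_pneg; lra).
      * apply (S2 _ _ _ H2).
      * intros ->; lra.
      * intros ->; lra.
    + injection E as <- <- <-.
      assert (Ha : In a L1) by (apply (subseq_incl _ _ a H1); simpl; auto).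
      assert (Hb : In b L1) by (apply (subseq_incl _ _ b H1); simpl; auto).
      assert (Hc' : In c L2) by (apply (subseq_incl _ _ c H2); simpl; auto).
      apply I1 in Ha as [? Ca], Hb as [? Cb]; apply I2 in Hc' as [? ?].
      apply (upper_lower_orient S p); auto; try lra.
      * apply (S1 _ _ _ H1).
      * intros ->; lra.
      * intros ->; lra.
    + injection E as <- <- <- <-.
      apply T1 in H1 as ((Ha & Hb & Hc') & Hab & Hbc).
      apply I1 in Ha as [], Hb as [], Hc' as [].
      apply (upper_orient S p); auto.
    + discriminate.
  - intros a b c H1; apply T1 in H1 as ((Ha & Hb & Hc') & Hab & Hbc).
    apply I1 in Ha as [], Hb as [], Hc' as [].
    apply (upper_obtuse S p); auto.
  - intros a b c H2; apply T2 in H2 as ((Ha & Hb & Hc') & Hab & Hbc).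
    apply J2 in Ha as [], Hb as [], Hc' as [].
    apply (upper_obtuse S (pneg p)); auto.
Qed.

(** * The noncrossing matching between the chains *)

Lemma subseq_pair {A} (a b : A) L :
  a <> b -> In a L -> In b L -> subseq [a; b] L \/ subseq [b; a] L.
Proof.
  intros Hne; induction L as [|x L IH]; intros [] []; subst; try congruence.
  - left; constructor; now apply subseq_single.
  - right; constructor; now apply subseq_single.
  - destruct IH; [assumption|assumption|left|right]; now constructor.
Qed.

Lemma clockwise_general_position L a b c :
  clockwise L -> In a L -> In b L -> In c L ->
  a <> b -> a <> c -> b <> c -> orient a b c <> 0.
Proof.
  assert (Hhead : forall x L a b, clockwise (x :: L) -> a <> b -> In a L -> In b L ->
    orient x a b <> 0).
  { intros x L' a' b' Hcw Hne Ha Hb.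
    destruct (subseq_pair a' b' L' Hne Ha Hb) as [H|H].
    - assert (orient x a' b' < 0) by (apply Hcw; now constructor); lra.
    - assert (orient x b' a' < 0) by (apply Hcw; now constructor).
      rewrite orient_swap; lra. }
  intros Hcw Ha Hb Hc Hab Hac Hbc; induction L as [|x L IH]; [easy|].
  assert (IH' := fun Ha Hb Hc => IH (clockwise_cons_tail _ _ Hcw) Ha Hb Hc).
  destruct Ha as [->|Ha]; destruct Hb as [->|Hb]; destruct Hc as [->|Hc];
    try congruence; auto.
  - eauto.
  - rewrite orient_rot; eauto.
  - rewrite <- orient_rot; eauto.
Qed.

Lemma NoDup_app_disjoint {A} (L1 L2 : list A) x :
  NoDup (L1 ++ L2) -> In x L1 -> In x L2 -> False.
Proof.
  intros Hnd H1 H2; apply in_split in H1 as (l1 & l2 & ->).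
  rewrite <- app_assoc in Hnd; simpl in Hnd; apply NoDup_remove_2 in Hnd.
  apply Hnd; rewrite !in_app_iff; auto.
Qed.

Lemma Rmult_neg_neg a b : a < 0 -> b < 0 -> 0 < a * b.
Proof. nra. Qed.

(** [f] touches an endpoint of [e] or stays strictly on one side of the line through [e]. This is
    not symmetric, and one direction suffices against crossings, hence the disjunction in
    [noncrossing_pairs]. *)
Definition separated (e f : point * point) : Prop :=
  fst f = fst e \/ fst f = snd e \/ snd f = fst e \/ snd f = snd e \/
  0 < orient (fst e) (snd e) (fst f) * orient (fst e) (snd e) (snd f).

Definition noncrossing_pairs (M : list (point * point)) : Prop :=
  forall e f, In e M -> In f M -> e = f \/ separated e f \/ separated f e.

Definition is_matching (M : list (point * point)) : Prop :=
  forall e f, In e M -> In f M -> fst e = fst f \/ snd e = snd f -> e = f.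

Definition between (L1 L2 : list point) (M : list (point * point)) : Prop :=
  forall e, In e M -> In (fst e) L1 /\ In (snd e) L2.

(* The detour through (r, s) costs |rs| + t |ur| + t |sv| <= (2 t + 1) |uv| when both
   chains have stretch factor at most t. *)
Definition detour_pairs (L1 L2 : list point) (M : list (point * point)) : Prop :=
  forall u v, In u L1 -> In v L2 -> exists r s, In (r, s) M /\
    dist r s <= dist u v /\ dist u r + dist s v <= 2 * dist u v.

(** In the tour A1, r, B1, A2, s, B2 the line [r s] leaves [B1 ++ A2] on one side and [A1 ++ B2] on
    the other, each again a clockwise pair of chains. Neither is a tail of the input, so the
    induction is on a bound for the length of the first chain. *)
Lemma exists_matching_bounded n : forall L1 L2,
  (length L1 <= n)%nat -> clockwise (L1 ++ L2) -> NoDup (L1 ++ L2) ->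
  exists M, between L1 L2 M /\ is_matching M /\ noncrossing_pairs M /\ detour_pairs L1 L2 M.
Proof.
  induction n as [|n IH]; intros L1 L2 Hn Hcw Hnd.
  { destruct L1; [|simpl in Hn; lia].
    exists []; repeat split; try easy; intros ? ?; easy. }
  assert (Htriv : L1 = [] \/ L2 = [] \/ list_prod L1 L2 <> [])
    by (destruct L1, L2; simpl; auto; right; right; discriminate).
  destruct Htriv as [->|[->|Hne]].
  { exists []; repeat split; try easy; intros ? ?; easy. }
  { exists []; repeat split; try easy; intros ? ?; easy. }
  destruct (exists_argmin (fun e => dist (fst e) (snd e)) _ Hne) as ((r, s) & Hrs & Hmin).
  apply in_prod_iff in Hrs as [Hr Hs].
  assert (Hclosest : forall u v, In u L1 -> In v L2 -> dist r s <= dist u v)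
    by (intros u v Hu Hv; apply (Hmin (u, v)); now apply in_prod).
  clear Hmin Hne.
  apply in_split in Hr as (A1 & B1 & ->); apply in_split in Hs as (A2 & B2 & ->).
  assert (Hsub : forall l0 l1 l2 l3 l, subseq l0 A1 -> subseq l1 B1 -> subseq l2 A2 ->
    subseq l3 B2 -> subseq l (l0 ++ (r :: l1) ++ l2 ++ s :: l3) ->
    subseq l ((A1 ++ r :: B1) ++ A2 ++ s :: B2)).
  { intros l0 l1 l2 l3 l H0 H1 H2 H3 Hl; eapply subseq_trans; [exact Hl|].
    rewrite (app_assoc l0); repeat apply subseq_app; try assumption;
      apply subseq_take; assumption. }
  assert (Hcw1 : clockwise (B1 ++ A2)).
  { eapply clockwise_subseq; [|exact Hcw].
    apply (Hsub [] B1 A2 []); try apply subseq_refl; try constructor.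
    apply subseq_app; [apply subseq_refl|].
    rewrite <- (app_nil_r A2) at 1; apply subseq_app; [apply subseq_refl | constructor]. }
  assert (Hcw2 : clockwise (A1 ++ B2)).
  { eapply clockwise_subseq; [|exact Hcw].
    apply (Hsub A1 [] [] B2); try apply subseq_refl; try constructor.
    simpl; apply subseq_app; [apply subseq_refl|]; repeat constructor; apply subseq_refl. }
  assert (Hdis := fun x => NoDup_app_disjoint _ _ x Hnd).
  assert (Hnd1 : NoDup (A1 ++ r :: B1)) by (eapply NoDup_app_remove_r; exact Hnd).
  assert (Hnd2 : NoDup (A2 ++ s :: B2)) by (eapply NoDup_app_remove_l; exact Hnd).
  assert (Hnda : NoDup (B1 ++ A2)).
  { apply NoDup_app.
    - apply NoDup_app_remove_l in Hnd1; now inversion Hnd1.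
    - eapply NoDup_app_remove_r; exact Hnd2.
    - intros x H1 H2; apply (Hdis x); rewrite in_app_iff; simpl; auto. }
  assert (Hndb : NoDup (A1 ++ B2)).
  { apply NoDup_app.
    - eapply NoDup_app_remove_r; exact Hnd1.
    - apply NoDup_app_remove_l in Hnd2; now inversion Hnd2.
    - intros x H1 H2; apply (Hdis x); rewrite in_app_iff; simpl; auto. }
  rewrite length_app in Hn; simpl in Hn.
  destruct (IH B1 A2) as (Ma & Ba & Ia & Na & Da); [lia|assumption|assumption|].
  destruct (IH A1 B2) as (Mb & Bb & Ib & Nb & Db); [lia|assumption|assumption|].
  assert (Hr1 : ~ In r A1 /\ ~ In r B1).
  { apply NoDup_remove_2 in Hnd1; rewrite in_app_iff in Hnd1; tauto. }
  assert (Hs1 : ~ In s A2 /\ ~ In s B2).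
  { apply NoDup_remove_2 in Hnd2; rewrite in_app_iff in Hnd2; tauto. }
  assert (HAB1 := fun x => NoDup_app_disjoint _ _ x Hnd1).
  assert (HAB2 := fun x => NoDup_app_disjoint _ _ x Hnd2).
  (* Pairs of [Ma] are to the left of the directed line from [r] to [s], pairs of [Mb] to the right.
     For [Hab], the line through a pair of [Ma] has all of [Mb] on its right. *)
  assert (Hnewa : forall e, In e Ma -> separated (r, s) e).
  { intros [c d] He; apply Ba in He as [Hc Hd]; simpl in *.
    apply subseq_single in Hc, Hd.
    assert (orient r c s < 0) by (apply Hcw, (Hsub [] [c] [] []); repeat constructor; auto).
    assert (orient r d s < 0) by (apply Hcw, (Hsub [] [] [d] []); repeat constructor; auto).
    unfold separated; simpl; do 4 right.
    rewrite (orient_swap r s c), (orient_swap r s d); apply Rmult_lt_0_compat; lra. }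
  assert (Hnewb : forall e, In e Mb -> separated (r, s) e).
  { intros [c d] He; apply Bb in He as [Hc Hd]; simpl in *.
    apply subseq_single in Hc, Hd.
    assert (orient c r s < 0) by (apply Hcw, (Hsub [c] [] [] []); repeat constructor; auto).
    assert (orient r s d < 0) by (apply Hcw, (Hsub [] [] [] [d]); repeat constructor; auto).
    unfold separated; simpl; do 4 right.
    rewrite <- (orient_rot c r s); now apply Rmult_neg_neg. }
  assert (Hab : forall e f, In e Ma -> In f Mb -> separated e f).
  { intros [c d] [e f] He Hf; apply Ba in He as [Hc Hd]; apply Bb in Hf as [He Hf].
    simpl in *; apply subseq_single in Hc, Hd, He, Hf.
    assert (orient e c d < 0) by (apply Hcw, (Hsub [e] [c] [d] []); repeat constructor; auto).
    assert (orient c d f < 0) by (apply Hcw, (Hsub [] [c] [d] [f]); repeat constructor; auto).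
    unfold separated; simpl; do 4 right.
    rewrite <- (orient_rot e c d); now apply Rmult_neg_neg. }
  exists ((r, s) :: Ma ++ Mb); split; [|split; [|split]].
  - intros e [<-|He]; [rewrite !in_app_iff; simpl; auto|].
    apply in_app_iff in He as [He|He]; [apply Ba in He | apply Bb in He];
      rewrite !in_app_iff; simpl; tauto.
  - assert (Hnab : forall e f, In e Ma -> In f Mb -> fst e = fst f \/ snd e = snd f -> False).
    { intros e f He Hf; apply Ba in He as [He1 He2]; apply Bb in Hf as [Hf1 Hf2].
      intros [E|E].
      - apply (HAB1 (fst f)); [|simpl; rewrite <- E]; auto.
      - apply (HAB2 (snd e)); [|simpl; rewrite E]; auto. }
    assert (Hna : forall e, In e Ma -> r = fst e \/ s = snd e -> False).
    { intros e He; apply Ba in He as [He1 He2]; intros [->| ->]; tauto. }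
    assert (Hnb : forall e, In e Mb -> r = fst e \/ s = snd e -> False).
    { intros e He; apply Bb in He as [He1 He2]; intros [->| ->]; tauto. }
    intros e f [<-|He] [<-|Hf] Hef; auto.
    + exfalso; apply in_app_iff in Hf as [Hf|Hf]; eauto.
    + exfalso; simpl in Hef; apply in_app_iff in He as [He|He];
        [apply (Hna e) | apply (Hnb e)]; auto; intuition.
    + apply in_app_iff in He as [He|He]; apply in_app_iff in Hf as [Hf|Hf]; auto.
      * exfalso; eauto.
      * exfalso; apply (Hnab f e); auto; intuition.
  - intros e f [<-|He] [<-|Hf]; auto.
    + right; left; apply in_app_iff in Hf as [Hf|Hf]; auto.
    + right; right; apply in_app_iff in He as [He|He]; auto.
    + apply in_app_iff in He as [He|He]; apply in_app_iff in Hf as [Hf|Hf]; auto.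
  - intros u v Hu Hv.
    pose proof (Hclosest u v Hu Hv) as Huv.
    assert (Hself : dist u r + dist s v <= 2 * dist u v ->
      exists r' s', In (r', s') ((r, s) :: Ma ++ Mb) /\
        dist r' s' <= dist u v /\ dist u r' + dist s' v <= 2 * dist u v)
      by (intros; exists r, s; simpl; auto).
    (* [A1] with [A2] and [B1] with [B2] are separated by [r s] and need the quadrilateral. [A1]
       with [B2] and [B1] with [A2] are left to the recursion. If u = r or v = s, the triangle
       inequality is enough. *)
    apply in_app_iff in Hu as [Hu|[<-|Hu]]; apply in_app_iff in Hv as [Hv|[<-|Hv]].
    + apply Hself. apply subseq_single in Hu, Hv.
      assert (H : dist u r + dist v s <= dist u v + dist r s).
      { apply sides_le_diagonals. eapply clockwise_subseq; [|exact Hcw].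
        apply (Hsub [u] [] [v] []); repeat constructor; auto. }
      rewrite (dist_sym s v); lra.
    + apply Hself. rewrite dist_refl.
      pose proof (dist_triangle u s r); rewrite (dist_sym s r) in *; lra.
    + destruct (Db u v Hu Hv) as (r' & s' & H & H'); exists r', s'; split; [|assumption].
      right; apply in_app_iff; auto.
    + apply Hself. rewrite dist_refl.
      pose proof (dist_triangle s r v); rewrite (dist_sym s r) in *; lra.
    + apply Hself. rewrite !dist_refl; pose proof (dist_nonneg r s); lra.
    + apply Hself. rewrite dist_refl.
      pose proof (dist_triangle s r v); rewrite (dist_sym s r) in *; lra.
    + destruct (Da u v Hu Hv) as (r' & s' & H & H'); exists r', s'; split; [|assumption].
      right; apply in_app_iff; auto.
    + apply Hself. rewrite dist_refl.
      pose proof (dist_triangle u s r); rewrite (dist_sym s r) in *; lra.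
    + apply Hself. apply subseq_single in Hu, Hv.
      assert (H : dist r u + dist s v <= dist r s + dist u v).
      { apply sides_le_diagonals. eapply clockwise_subseq; [|exact Hcw].
        apply (Hsub [] [u] [] [v]); repeat constructor; auto. }
      rewrite (dist_sym u r); lra.
Qed.

(** * Edges along a chain *)

Fixpoint adjacent (L : list point) : list (point * point) :=
  match L with
  | a :: (b :: _) as L' => (a, b) :: adjacent L'
  | _ => []
  end.

Lemma adjacent_split a b L :
  In (a, b) (adjacent L) <-> exists l1 l2, L = l1 ++ a :: b :: l2.
Proof.
  split.
  - induction L as [|x [|y L] IH]; try easy.
    intros [E|H].
    + injection E as -> ->; exists [], L; reflexivity.
    + destruct (IH H) as (l1 & l2 & E); exists (x :: l1), l2; rewrite E; reflexivity.
  - intros (l1 & l2 & ->); induction l1 as [|x l1 IH]; [now left|].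
    simpl; destruct (l1 ++ a :: b :: l2); [easy | now right].
Qed.

Lemma adjacent_app_l L1 L2 e : In e (adjacent L1) -> In e (adjacent (L1 ++ L2)).
Proof.
  destruct e as [a b]; intros H; apply adjacent_split in H as (l1 & l2 & ->).
  apply adjacent_split; exists l1, (l2 ++ L2); now rewrite <- app_assoc.
Qed.

Lemma adjacent_app_r L1 L2 e : In e (adjacent L2) -> In e (adjacent (L1 ++ L2)).
Proof.
  destruct e as [a b]; intros H; apply adjacent_split in H as (l1 & l2 & ->).
  apply adjacent_split; exists (L1 ++ l1), l2; now rewrite <- app_assoc.
Qed.

Lemma adjacent_In a b L : In (a, b) (adjacent L) -> In a L /\ In b L.
Proof.
  intros H; apply adjacent_split in H as (l1 & l2 & ->).
  rewrite !in_app_iff; simpl; auto.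
Qed.

Lemma adjacent_neq a b L : NoDup L -> In (a, b) (adjacent L) -> a <> b.
Proof.
  intros Hnd H; apply adjacent_split in H as (l1 & l2 & ->).
  apply NoDup_app_remove_l in Hnd; inversion Hnd; simpl in *; intuition.
Qed.

Lemma adjacent_succ_unique a b c L :
  NoDup L -> In (a, b) (adjacent L) -> In (a, c) (adjacent L) -> b = c.
Proof.
  intros Hnd; induction Hnd as [|x L Hx Hnd IH]; [easy|].
  destruct L as [|y L]; [easy|].
  change (adjacent (x :: y :: L)) with ((x, y) :: adjacent (y :: L)).
  intros [E|H] [E'|H']; try congruence; auto; exfalso; apply Hx.
  - injection E as -> ->; now apply adjacent_In in H'.
  - injection E' as -> ->; now apply adjacent_In in H.
Qed.

Lemma adjacent_pred_unique a b c L :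
  NoDup L -> In (b, a) (adjacent L) -> In (c, a) (adjacent L) -> b = c.
Proof.
  intros Hnd H; apply adjacent_split in H as (l1 & l2 & ->).
  intros H'; apply adjacent_split in H' as (l1' & l2' & E).
  (* Regrouped so that [b] and [c] end the prefix before [a]; without duplicates this prefix is
     unique. *)
  change (l1 ++ b :: a :: l2) with (l1 ++ [b] ++ a :: l2) in *.
  change (l1' ++ c :: a :: l2') with (l1' ++ [c] ++ a :: l2') in *.
  rewrite !app_assoc in *.
  assert (Hu : l1 ++ [b] = l1' ++ [c]).
  { revert E Hnd; generalize (l1 ++ [b]) (l1' ++ [c]); clear.
    intros l; induction l as [|x l IH]; intros [|y l'] E Hnd; simpl in *; auto.
    - injection E as -> ->. inversion Hnd as [|? ? Hn]; subst.
      exfalso; apply Hn, in_app_iff; simpl; auto.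
    - injection E as -> E. inversion Hnd as [|? ? Hn]; subst.
      exfalso; apply Hn; rewrite in_app_iff; simpl; auto.
    - injection E as -> E; f_equal; apply IH; [assumption|now inversion Hnd]. }
  now apply app_inj_tail in Hu.
Qed.

Lemma adjacent_orient L a b c :
  clockwise L -> In (a, b) (adjacent L) -> In c L -> c <> a -> c <> b -> orient a b c < 0.
Proof.
  intros Hcw H Hc Ha Hb; apply adjacent_split in H as (l1 & l2 & ->).
  apply in_app_iff in Hc as [Hc|[Hc|[Hc|Hc]]]; try congruence.
  - rewrite <- orient_rot; apply Hcw.
    apply (subseq_app [c] [a; b]); [now apply subseq_single | repeat constructor].
  - apply Hcw, subseq_app_left; do 2 constructor; now apply subseq_single.
Qed.

(** A polygon edge has all other vertices on its right, so [f] may be any pair of vertices, in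
    particular a matching pair. *)
Lemma adjacent_separated L e f :
  clockwise L -> In e (adjacent L) -> In (fst f) L -> In (snd f) L -> separated e f.
Proof.
  destruct e as [a b], f as [c d]; intros Hcw He Hc Hd; unfold separated; simpl in *.
  destruct (point_eq_dec c a), (point_eq_dec c b), (point_eq_dec d a), (point_eq_dec d b);
    auto.
  do 4 right.
  pose proof (adjacent_orient L a b c Hcw He Hc); pose proof (adjacent_orient L a b d Hcw He Hd).
  apply Rmult_neg_neg; auto.
Qed.

(** * Planarity from separation *)

Lemma orient_on_segment a b x : on_segment a b x -> orient a b x = 0.
Proof. intros (t & _ & Hx & Hy); unfold orient; rewrite Hx, Hy; ring. Qed.

Lemma on_segment_sym a b x : on_segment a b x -> on_segment b a x.
Proof.
  intros (t & Ht & Hx & Hy); exists (1 - t); split; [lra|]; rewrite Hx, Hy; split; ring.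
Qed.

Lemma orient_affine a b c d x t :
  fst x = (1 - t) * fst c + t * fst d -> snd x = (1 - t) * snd c + t * snd d ->
  orient a b x = (1 - t) * orient a b c + t * orient a b d.
Proof. intros Hx Hy; unfold orient; rewrite Hx, Hy; ring. Qed.

Lemma same_sign_segment x y t :
  0 < x * y -> 0 <= t <= 1 -> (1 - t) * x + t * y <> 0.
Proof.
  intros Hxy Ht E.
  assert (E' : (1 - t) * (x * x) + t * (x * y) = 0)
    by (transitivity (x * ((1 - t) * x + t * y)); [ring | rewrite E; ring]).
  assert (0 <= (1 - t) * (x * x)) by (apply Rmult_le_pos; [lra | apply Rle_0_sqr]).
  destruct (Req_dec t 0) as [->|Hne]; [nra|].
  assert (0 < t * (x * y)) by (apply Rmult_lt_0_compat; lra).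
  lra.
Qed.

Lemma separated_meet L a b c d x :
  clockwise L -> In a L -> In b L -> In c L -> In d L -> a <> b -> c <> d ->
  ~ ((a = c /\ b = d) \/ (a = d /\ b = c)) ->
  separated (a, b) (c, d) ->
  on_segment a b x -> on_segment c d x ->
  (x = a \/ x = b) /\ (x = c \/ x = d).
Proof.
  intros Hcw Ha Hb Hc Hd Hab Hcd Hne Hsep Hx1 Hx2.
  assert (Hgp : forall e, In e L -> orient a b e = 0 -> e = a \/ e = b).
  { intros e He E.
    destruct (point_eq_dec e a); [now left|]; destruct (point_eq_dec e b); [now right|].
    exfalso; revert E; apply (clockwise_general_position L); auto. }
  pose proof (orient_on_segment _ _ _ Hx1) as E.
  (* For a shared endpoint [c], the orientation of [x] against [a b] is t times that of [d]. It
     vanishes only if t = 0, or if [d] is also [a] or [b], which would make the two edges equal. *)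
  assert (Hend : forall c d, In d L -> c <> d ->
    ~ ((a = c /\ b = d) \/ (a = d /\ b = c)) -> c = a \/ c = b ->
    on_segment c d x -> x = c).
  { clear c d Hc Hd Hcd Hne Hsep Hx2.
    intros c d Hd Hcd Hne Hcab (t & Ht & Hx & Hy).
    rewrite (orient_affine a b c d x t Hx Hy) in E.
    assert (E' : orient a b c = 0) by (destruct Hcab; subst; unfold orient; ring).
    rewrite E', Rmult_0_r, Rplus_0_l in E.
    apply Rmult_integral in E as [->|E].
    - destruct x, c; simpl in *; f_equal; lra.
    - apply Hgp in E; [|assumption]. exfalso; destruct Hcab, E; subst; tauto. }
  assert (Hends : c = a \/ c = b \/ d = a \/ d = b -> (x = a \/ x = b) /\ (x = c \/ x = d)).
  { intros H.
    assert (Hcd' : (c = a \/ c = b) \/ (d = a \/ d = b)) by tauto.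
    destruct Hcd' as [H'|H'].
    - rewrite (Hend c d); auto.
    - rewrite (Hend d c); auto; [tauto|now apply on_segment_sym]. }
  unfold separated in Hsep; simpl in Hsep.
  destruct Hsep as [H|[H|[H|[H|H]]]]; auto.
  exfalso. destruct Hx2 as (t & Ht & Hx & Hy).
  rewrite (orient_affine a b c d x t Hx Hy) in E.
  revert E; now apply same_sign_segment.
Qed.

(** * Walks and the stretch of a chain *)

Definition reach (E : point -> point -> bool) (u v : point) (r : R) : Prop :=
  exists l, is_walk E u l /\ last l u = v /\ walk_length u l <= r.

Lemma walk_app E l1 : forall u l2,
  is_walk E u l1 -> is_walk E (last l1 u) l2 ->
  is_walk E u (l1 ++ l2) /\ last (l1 ++ l2) u = last l2 (last l1 u) /\
  walk_length u (l1 ++ l2) = walk_length u l1 + walk_length (last l1 u) l2.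
Proof.
  assert (Hlast : forall (l : list point) x u, last (x :: l) u = last l x).
  { induction l as [|y l IH]; intros x u; [reflexivity|].
    change (last (x :: y :: l) u) with (last (y :: l) u).
    rewrite (last_default l y u x); reflexivity. }
  induction l1 as [|x l1 IH]; intros u l2 H1 H2.
  - simpl in *; repeat split; auto; ring.
  - rewrite Hlast in *; destruct H1 as [He H1].
    destruct (IH x l2 H1 H2) as (Hw & Hl & Hlen).
    change ((x :: l1) ++ l2) with (x :: (l1 ++ l2)); rewrite Hlast.
    simpl; rewrite Hlen; repeat split; auto; ring.
Qed.

Lemma reach_refl E u r : 0 <= r -> reach E u u r.
Proof. exists []; simpl; auto. Qed.

Lemma reach_edge E u v : E u v = true -> reach E u v (dist u v).
Proof. exists [v]; simpl; repeat split; auto; lra. Qed.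

Lemma reach_trans E u v w r s : reach E u v r -> reach E v w s -> reach E u w (r + s).
Proof.
  intros (l1 & H1 & <- & Hr) (l2 & H2 & <- & Hs).
  destruct (walk_app E l1 u l2 H1 H2) as (Hw & Hl & Hlen).
  exists (l1 ++ l2); repeat split; auto; lra.
Qed.

Lemma reach_le E u v r s : r <= s -> reach E u v r -> reach E u v s.
Proof. intros Hrs (l & ? & ? & ?); exists l; repeat split; auto; lra. Qed.

Lemma reach_sym E u v r :
  (forall p q, E p q = true -> E q p = true) -> reach E u v r -> reach E v u r.
Proof.
  intros Hsym (l & Hw & Hl & Hr).
  cut (reach E v u (walk_length u l)); [now apply reach_le|].
  clear r Hr; revert u Hw Hl; induction l as [|x l IH]; intros u Hw Hl.
  - simpl in *; subst; apply reach_refl; lra.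
  - destruct Hw as [He Hw]. simpl walk_length.
    rewrite Rplus_comm; apply reach_trans with x.
    + apply IH; [assumption|]. destruct l; [assumption|].
      rewrite <- Hl; exact (last_default l p x u).
    + rewrite dist_sym; apply reach_edge; auto.
Qed.

Lemma is_walk_adjacent E l : forall u,
  (forall a b, In (a, b) (adjacent (u :: l)) -> E a b = true) -> is_walk E u l.
Proof.
  induction l as [|x l IH]; intros u H; simpl; [easy|]; split.
  - apply H; now left.
  - apply IH; intros a b Hab; apply H; now right.
Qed.

Lemma chain_stretch E L u v :
  (forall p q, E p q = true -> E q p = true) ->
  (forall a b, In (a, b) (adjacent L) -> E a b = true) ->
  NoDup L -> clockwise L -> (forall a b c, subseq [a; b; c] L -> obtuse a b c) ->
  In u L -> In v L -> reach E u v (PI / 2 * dist u v).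
Proof.
  intros Hsym Hadj Hnd Hcw Hob Hu Hv.
  assert (Hpos : forall a b, 0 <= PI / 2 * dist a b).
  { intros; apply Rmult_le_pos; [pose proof PI_RGT_0; lra | apply dist_nonneg]. }
  destruct (point_eq_dec u v) as [->|Hne]; [now apply reach_refl|].
  assert (Hord : forall u v, u <> v -> subseq [u; v] L -> reach E u v (PI / 2 * dist u v)).
  { clear u v Hu Hv Hne; intros u v Hne Huv.
    (* The walk is the contiguous stretch of [L] from [u] to [v]. *)
    assert (Hsplit : exists l1 B C, L = l1 ++ (u :: B ++ [v]) ++ C).
    { clear - Huv; induction L as [|x L IH]; inversion Huv as [|? ? ? H|? ? ? H]; subst.
      - apply (subseq_incl _ _ v) in H; [|now left].
        apply in_split in H as (B & C & ->).
        exists [], B, C; simpl; now rewrite <- app_assoc.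
      - destruct (IH H) as (l1 & B & C & ->); exists (x :: l1), B, C; reflexivity. }
    destruct Hsplit as (l1 & B & C & ->).
    assert (Hinfix : subseq (u :: B ++ [v]) (l1 ++ (u :: B ++ [v]) ++ C)).
    { apply subseq_app_left; rewrite <- (app_nil_r (u :: B ++ [v])) at 1.
      apply subseq_app; [apply subseq_refl | constructor]. }
    exists (B ++ [v]); repeat split.
    - apply is_walk_adjacent; intros a b Hab; apply Hadj.
      apply adjacent_app_r, adjacent_app_l; assumption.
    - apply last_last.
    - apply convex_chain_length; [assumption|eapply clockwise_subseq; eassumption|].
      intros w Hw; apply Hob; eapply subseq_trans; [|exact Hinfix].
      constructor; apply (subseq_app [w] [v]); [now apply subseq_single|apply subseq_refl]. }
  destruct (subseq_pair u v L Hne Hu Hv) as [H|H]; [now apply Hord|].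
  apply reach_sym; [assumption|]; rewrite dist_sym; apply Hord; auto.
Qed.

(** * Degree count and assembly *)

Lemma length_le_3 {A} (l : list A) (P1 P2 P3 : A -> Prop) :
  NoDup l ->
  (forall x, In x l -> P1 x \/ P2 x \/ P3 x) ->
  (forall x y, P1 x -> P1 y -> x = y) ->
  (forall x y, P2 x -> P2 y -> x = y) ->
  (forall x y, P3 x -> P3 y -> x = y) ->
  (length l <= 3)%nat.
Proof.
  intros Hnd HP U1 U2 U3.
  destruct l as [|a [|b [|c [|d l]]]]; simpl; try lia; exfalso.
  inversion Hnd as [|? ? Ha Hnd1]; inversion Hnd1 as [|? ? Hb Hnd2];
    inversion Hnd2 as [|? ? Hc _]; subst; simpl in *.
  assert (a <> b /\ a <> c /\ a <> d /\ b <> c /\ b <> d /\ c <> d)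
    as (N1 & N2 & N3 & N4 & N5 & N6) by (repeat split; intros ->; tauto).
  destruct (HP a) as [?|[?|?]], (HP b) as [?|[?|?]], (HP c) as [?|[?|?]], (HP d) as [?|[?|?]];
    auto 6; eauto.
Qed.

Definition pair_eq_dec (e f : point * point) : {e = f} + {e <> f}.
Proof. decide equality; apply point_eq_dec. Defined.

Definition graph_of (D : list (point * point)) (p q : point) : bool :=
  if in_dec pair_eq_dec (p, q) D then true
  else if in_dec pair_eq_dec (q, p) D then true else false.

Lemma graph_of_true D p q : graph_of D p q = true <-> In (p, q) D \/ In (q, p) D.
Proof.
  unfold graph_of; destruct (in_dec _ (p, q) D); [tauto|].
  destruct (in_dec _ (q, p) D); [tauto|]. split; [discriminate|tauto].
Qed.

Theorem theorem5 :
  forall S : list point,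
    NoDup S ->
    centrally_symmetric S ->
    convex_position S ->
    exists E : point -> point -> bool,
      geometric_graph S E /\
      plane E /\
      stretch_at_most S E (PI + 1) /\
      max_degree_at_most S E 3.
Proof.
  intros S HndS Hsym Hconv.
  (* With no point off the origin there is no axis; the graph without edges then works. *)
  assert (Htriv : (exists p, farthest S p) \/ forall x, In x S -> x = (0, 0)).
  { destruct S as [|x0 S']; [right; easy|].
    destruct (exists_argmin (fun x => - normsq x) (x0 :: S')) as (p & Hp & Hmax);
      [discriminate|].
    destruct (Rlt_dec 0 (normsq p)) as [H0|H0].
    - left; exists p; repeat split; auto.
      intros x Hx; specialize (Hmax x Hx); lra.
    - right; intros [a b] Hx; specialize (Hmax _ Hx); unfold normsq in *; simpl in *.
      f_equal; nra. }
  destruct Htriv as [(p & Hp)|H0].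
  2:{ exists (fun _ _ => false); repeat split; try easy.
      - intros u v Hu Hv; rewrite (H0 u Hu), (H0 v Hv); exists [].
        rewrite dist_refl; simpl; repeat split; lra.
      - intros u _; unfold degree. clear; induction S; simpl; auto. }
  destruct (exists_clockwise_order S p HndS Hconv Hp)
    as (L1 & L2 & Hperm & Hcw & Hob1 & Hob2).
  assert (Hnd : NoDup (L1 ++ L2)) by (eapply Permutation_NoDup; eassumption).
  assert (HS : forall x, In x S <-> In x (L1 ++ L2))
    by (intros x; split; apply Permutation_in; [|symmetry]; assumption).
  destruct (exists_matching_bounded (length L1) L1 L2)
    as (M & HB & HI & HN & HD); [lia|assumption|assumption|].
  set (D := adjacent L1 ++ adjacent L2 ++ M).
  (* The concatenation may add one adjacent pair, at the junction of the chains. It is not an edge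
     from the chains, but allowing it lets one list serve planarity and degrees. *)
  assert (HDcase : forall e, In e D -> In e (adjacent (L1 ++ L2)) \/ In e M).
  { intros e He; apply in_app_iff in He as [He|He]; [left; now apply adjacent_app_l|].
    apply in_app_iff in He as [He|He]; [left; now apply adjacent_app_r|now right]. }
  assert (HDin : forall a b, In (a, b) D -> In a (L1 ++ L2) /\ In b (L1 ++ L2)).
  { intros a b He; apply HDcase in He as [He|He]; [now apply adjacent_In|].
    apply HB in He; rewrite !in_app_iff; simpl in He; tauto. }
  assert (HDne : forall a b, In (a, b) D -> a <> b).
  { intros a b He; apply HDcase in He as [He|He]; [eapply adjacent_neq; eassumption|].
    apply HB in He as [Ha Hb]; intros ->.
    exact (NoDup_app_disjoint _ _ _ Hnd Ha Hb). }
  assert (HDsep : forall e f, In e D -> In f D -> e = f \/ separated e f \/ separated f e).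
  { intros [a b] [c d] He Hf; pose proof (HDin _ _ He) as []; pose proof (HDin _ _ Hf) as [].
    apply HDcase in He as [He|He]; apply HDcase in Hf as [Hf|Hf]; auto;
      right; (left + right); now apply (adjacent_separated (L1 ++ L2)). }
  assert (HEsym : forall a b, graph_of D a b = true -> graph_of D b a = true)
    by (intros a b; rewrite !graph_of_true; tauto).
  exists (graph_of D); split; [|split; [|split]].
  - repeat split.
    + apply graph_of_true in H as [H|H]; apply HDin in H; apply HS; tauto.
    + apply graph_of_true in H as [H|H]; apply HDin in H; apply HS; tauto.
    + assumption.
    + intros a; destruct (graph_of D a a) eqn:E; [|reflexivity].
      apply graph_of_true in E as [E|E]; now apply HDne in E.
  - assert (HP : forall a b c d x, In (a, b) D -> In (c, d) D ->
      ~ ((a = c /\ b = d) \/ (a = d /\ b = c)) ->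
      on_segment a b x -> on_segment c d x -> (x = a \/ x = b) /\ (x = c \/ x = d)).
    { intros a b c d x He Hf Hne Hx1 Hx2.
      pose proof (HDin _ _ He) as []; pose proof (HDin _ _ Hf) as [].
      pose proof (HDne _ _ He); pose proof (HDne _ _ Hf).
      destruct (HDsep _ _ He Hf) as [E|[Hs|Hs]].
      - injection E as -> ->; tauto.
      - apply (separated_meet (L1 ++ L2)); auto.
      - apply and_comm; apply (separated_meet (L1 ++ L2)); auto.
        intuition. }
    intros a b c d x He Hf Hne Hx1 Hx2.
    pose proof (on_segment_sym _ _ _ Hx1); pose proof (on_segment_sym _ _ _ Hx2).
    apply graph_of_true in He as [He|He]; apply graph_of_true in Hf as [Hf|Hf].
    + apply HP; auto.
    + cut ((x = a \/ x = b) /\ (x = d \/ x = c)); [tauto|]. apply HP; auto; tauto.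
    + cut ((x = b \/ x = a) /\ (x = c \/ x = d)); [tauto|]. apply HP; auto; tauto.
    + cut ((x = b \/ x = a) /\ (x = d \/ x = c)); [tauto|]. apply HP; auto; tauto.
  - assert (HC1 : forall u v, In u L1 -> In v L1 -> reach (graph_of D) u v (PI / 2 * dist u v)).
    { intros u v; apply chain_stretch; auto.
      - intros a b H; apply graph_of_true; left; apply in_app_iff; auto.
      - eapply NoDup_app_remove_r; exact Hnd.
      - eapply clockwise_subseq; [|exact Hcw].
        rewrite <- (app_nil_r L1) at 1; apply subseq_app; [apply subseq_refl|constructor]. }
    assert (HC2 : forall u v, In u L2 -> In v L2 -> reach (graph_of D) u v (PI / 2 * dist u v)).
    { intros u v; apply chain_stretch; auto.
      - intros a b H; apply graph_of_true; left; unfold D; rewrite !in_app_iff; auto.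
      - eapply NoDup_app_remove_l; exact Hnd.
      - eapply clockwise_subseq; [|exact Hcw]. apply subseq_app_left, subseq_refl. }
    assert (HC12 : forall u v, In u L1 -> In v L2 ->
      reach (graph_of D) u v ((PI + 1) * dist u v)).
    { intros u v Hu Hv; destruct (HD u v Hu Hv) as (r & s & Hrs & Hle & Hdet).
      destruct (HB _ Hrs) as [Hr Hs]; simpl in Hr, Hs.
      apply reach_le with (PI / 2 * dist u r + (dist r s + PI / 2 * dist s v)).
      - pose proof PI_RGT_0; nra.
      - apply reach_trans with r; [now apply HC1|].
        apply reach_trans with s; [|now apply HC2].
        apply reach_edge, graph_of_true; left; unfold D; rewrite !in_app_iff; auto. }
    assert (Hweak : forall u v, PI / 2 * dist u v <= (PI + 1) * dist u v).
    { intros u v; pose proof (dist_nonneg u v); pose proof PI_RGT_0; nra. }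
    intros u v Hu Hv; change (reach (graph_of D) u v ((PI + 1) * dist u v)).
    apply HS, in_app_iff in Hu as [Hu|Hu]; apply HS, in_app_iff in Hv as [Hv|Hv].
    + eapply reach_le; [apply Hweak|auto].
    + auto.
    + apply reach_sym; [assumption|]; rewrite dist_sym; auto.
    + eapply reach_le; [apply Hweak|auto].
  - intros a Ha; unfold degree.
    apply length_le_3 with (P1 := fun b => In (a, b) (adjacent (L1 ++ L2)))
      (P2 := fun b => In (b, a) (adjacent (L1 ++ L2)))
      (P3 := fun b => In (a, b) M \/ In (b, a) M).
    + now apply NoDup_filter.
    + intros b Hb; apply filter_In in Hb as [_ Hb].
      apply graph_of_true in Hb as [Hb|Hb]; apply HDcase in Hb; tauto.
    + intros b c; now apply adjacent_succ_unique.
    + intros b c; now apply adjacent_pred_unique.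
    (* In the mixed cases [a] would be in both chains. *)
    + intros b c [Hb|Hb] [Hc|Hc].
      * specialize (HI _ _ Hb Hc (or_introl eq_refl)); congruence.
      * apply HB in Hb as [Hb _], Hc as [_ Hc].
        destruct (NoDup_app_disjoint _ _ _ Hnd Hb Hc).
      * apply HB in Hb as [_ Hb], Hc as [Hc _].
        destruct (NoDup_app_disjoint _ _ _ Hnd Hc Hb).
      * specialize (HI _ _ Hb Hc (or_intror eq_refl)); congruence.
Qed.
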